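(* Let $U$ be an optimal machine. Then: (a) $\underline{E}(A)>0$ for every algorithm $A$; (b) there exists $\varepsilon>0$ such that $\overline{E}(A)\ge \varepsilon$ for every algorithm $A$; (c) for every $\varepsilon>0$ there exists an algorithm $A$ such that $\underline{E}(A)\le\varepsilon$; (d) if we consider only algorithms that may be undefined but never produce wrong answers, then the statement ``for every $\varepsilon>0$ there exists an algorithm $A$ of this type such that $\underline{E}(A)\le\varepsilon$'' may be true or false depending on the choice of $U$; for example, it always holds when $U$ is left-total and never holds when $U$ is effectively optimal.
   Context: A machine is a partial computable function from binary strings to binary strings. For a machine $V$ let $C_V(x)=\min\{|p|\colon V(p)=x\}$. A machine $U$ is optimal if for every machine $V$ there is $c$ with $C_U(x)\le C_V(x)+c$ for all $x$. A machine $U$ is effectively optimal if for every machine $V$ there is a total computable function $h$ with $|h(x)|\le|x|+c$ for some $c$ and all $x$, such that $V(x)=U(h(x))$ for all $x$ (both undefined or both defined and equal). A machine is left-total if for every $n$ the $n$-bit strings in its domain form an initial segment in the lexicographic ordering. An algorithm $A$ is a partial computable function, viewed as an attempt to decide $\mathrm{dom}(U)$; $A$ errs on $x$ if $x\in\mathrm{dom}(U)$ and $A(x)$ does not output $1$, or $x\notin\mathrm{dom}(U)$ and $A(x)$ does not output $0$. $\varepsilon_n(A)$ is the fraction of such error strings among all strings of length at most $n$; $\overline{E}(A)=\limsup_n\varepsilon_n(A)$ and $\underline{E}(A)=\liminf_n\varepsilon_n(A)$. *)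

(* Defs.v *)
From Stdlib Require Import Reals List Arith ClassicalEpsilon.

Import ListNotations.
Local Open Scope nat_scope.

Inductive PR : Type :=
| PZ : PR
| PS : PR
| PP : nat -> PR
| PC : PR -> list PR -> PR
| PRec : PR -> PR -> PR
| PMu : PR -> PR.

Inductive ev : PR -> list nat -> nat -> Prop :=
| evZ xs : ev PZ xs 0
| evS xs : ev PS xs (S (List.hd 0 xs))
| evP i xs : ev (PP i) xs (List.nth i xs 0)
| evC f gs xs ys y : evs gs xs ys -> ev f ys y -> ev (PC f gs) xs y
| evR0 f g xs y : ev f xs y -> ev (PRec f g) (0 :: xs) y
| evRS f g n xs r y :
    ev (PRec f g) (n :: xs) r -> ev g (n :: r :: xs) y -> ev (PRec f g) (S n :: xs) y
| evMu f xs n :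
    ev f (n :: xs) 0 ->
    (forall m, m < n -> exists k, k <> 0 /\ ev f (m :: xs) k) ->
    ev (PMu f) xs n
with evs : list PR -> list nat -> list nat -> Prop :=
| evs0 xs : evs [] xs []
| evsC g gs xs y ys : ev g xs y -> evs gs xs ys -> evs (g :: gs) xs (y :: ys).

(* Standard bijection between binary strings and naturals:
   s |-> (the number with binary expansion 1s) - 1. *)
Definition num (s : list bool) : nat :=
  fold_left (fun acc (b : bool) => 2 * acc + (if b then 1 else 0)) s 1.
Definition code (s : list bool) : nat := num s - 1.

Definition bstr := list bool.

Definition pfun := bstr -> option bstr.

Definition computable (M : pfun) : Prop :=
  exists e : PR, forall x y, M x = Some y <-> ev e [code x] (code y).

Definition machine (M : pfun) : Prop := computable M.

Definition dom (M : pfun) (x : bstr) : Prop := exists y, M x = Some y.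

(* C_U(x) <= C_V(x) + c, with the convention min(empty) = infinity,
   written out: every V-description p of x yields a U-description of
   length at most |p| + c. *)
Definition C_le_plus (U V : pfun) (c : nat) : Prop :=
  forall x p, V p = Some x -> exists q, U q = Some x /\ length q <= length p + c.

Definition optimal (U : pfun) : Prop :=
  machine U /\ forall V, machine V -> exists c : nat, C_le_plus U V c.

Definition effectively_optimal (U : pfun) : Prop :=
  machine U /\
  forall V, machine V ->
    exists (h : bstr -> bstr) (c : nat),
      computable (fun x => Some (h x)) /\
      (forall x, length (h x) <= length x + c) /\
      (forall x, V x = U (h x)).

Fixpoint lex_le (x y : bstr) : Prop :=
  match x, y with
  | [], [] => True
  | a :: x', b :: y' =>
      (a = false /\ b = true) \/ (a = b /\ lex_le x' y')
  | _, _ => False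
  end.

Definition left_total (U : pfun) : Prop :=
  forall x y, length x = length y -> lex_le x y -> dom U y -> dom U x.

(* An algorithm is a partial computable function; output "1" is [true],
   output "0" is [false]. *)
Definition algorithm (A : pfun) : Prop := computable A.

Definition errs (U A : pfun) (x : bstr) : Prop :=
  (dom U x /\ A x <> Some [true]) \/ (~ dom U x /\ A x <> Some [false]).

Definition never_wrong (U A : pfun) : Prop :=
  forall x y, A x = Some y ->
    (y = [true] /\ dom U x) \/ (y = [false] /\ ~ dom U x).

From Coquelicot Require Import Coquelicot.


Fixpoint strs_len (n : nat) : list bstr :=
  match n with
  | 0 => cons (@nil bool) nil
  | S m => List.map (cons false) (strs_len m) ++ List.map (cons true) (strs_len m)
  end.
Definition strs_upto (n : nat) : list bstr := flat_map strs_len (List.seq 0 (S n)).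

Definition decP (P : Prop) : bool :=
  if excluded_middle_informative P then true else false.

Definition eps_n (U A : pfun) (n : nat) : R :=
  (INR (List.length (List.filter (fun x => decP (errs U A x)) (strs_upto n)))
   / INR (List.length (strs_upto n)))%R.

Definition E_upper (U A : pfun) : Rbar := LimSup_seq (eps_n U A).
Definition E_lower (U A : pfun) : Rbar := LimInf_seq (eps_n U A).

Definition approx_by_never_wrong (U : pfun) : Prop :=
  forall e : R, (0 < e)%R ->
    exists A, algorithm A /\ never_wrong U A /\ Rbar_le (E_lower U A) (Finite e).

(* Main.v *)
(** Everything is transported along the bijection [code], under which a string of length [n]
    becomes a number of size about [2^n] and constants in complexity become constant factors.

    (a), (b): if an algorithm errs on few inputs of length at most [n], then, running it and
    enumerating the halting computations that it predicts, one lists the outputs of all but few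
    halting programs of length at most [n].  The objects not listed then have short descriptions:
    [n] and the accuracy are read off the length of the description and a short prefix.  There are
    more such objects than halting programs left, a contradiction.  The algorithm itself may be a
    computable function of [n]; letting it run through all algorithms, each infinitely often, makes
    the bound in (b) uniform.

    (c): choose a rational just below the upper limit of the density of halting programs, along a
    sparse arithmetic progression of lengths; waiting until that density is reached leaves few
    programs undecided.  For a left-total machine the positions of the programs that could still
    halt are known, so that the other non-halting programs are rejected without error.

    (d), effectively optimal case: with [h] the reduction of a suitable machine [V] to [U], [V]
    halts on the first string of its block whose image under [h] is rejected by an algorithm of
    small index.  That algorithm is then wrong; hence algorithms that are never wrong reject no
    image of the block, although all but few of these images are outside the domain of [U]. *)

Require Import Defs.
From Stdlib Require Import Reals List Arith Lia Lra Bool ClassicalEpsilon.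
From Coquelicot Require Import Coquelicot.
Import ListNotations.
Local Open Scope nat_scope.

(** * Pairing of natural numbers *)

(* For fixed [a] this pairing is linear in [b], so prefixing a program costs a constant. *)
Definition pk (a b : nat) : nat := 2 ^ a * (2 * b + 1) - 1.

Lemma S_pk a b : S (pk a b) = 2 ^ a * (2 * b + 1).
Proof. unfold pk. pose proof (Nat.pow_nonzero 2 a). nia. Qed.

Lemma pk_inj a b a' b' : pk a b = pk a' b' -> a = a' /\ b = b'.
Proof.
  intros H. apply (f_equal S) in H. rewrite !S_pk in H. revert a' H.
  induction a as [|a IH]; intros [|a'] H; rewrite ?Nat.pow_succ_r' in H; simpl (2 ^ 0) in H;
    try lia.
  destruct (IH a') as [-> ->]; [nia | easy].
Qed.

(** Repeated halving: an even [z] has first component 0, and an odd [z] has first component one more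
    than that of [Nat.div2 z]. *)
Lemma unpk_sig z : {ab : nat * nat | pk (fst ab) (snd ab) = z}.
Proof.
  induction z as [z IH] using lt_wf_rec.
  destruct (Nat.even z) eqn:E.
  - exists (0, Nat.div2 z). apply Nat.even_spec in E. destruct E as [u ->].
    rewrite Nat.div2_double. unfold pk. cbn [fst snd]. simpl (2 ^ 0). lia.
  - pose proof (Nat.div2_odd z) as D.
    assert (O : Nat.odd z = true) by (unfold Nat.odd; now rewrite E).
    rewrite O in D. simpl Nat.b2n in D.
    destruct (IH (Nat.div2 z)) as [[a b] H]; [lia|].
    exists (S a, b). cbn [fst snd] in *. apply (f_equal S) in H.
    apply eq_add_S. rewrite S_pk in *. rewrite Nat.pow_succ_r'. lia.
Qed.

Definition pf (z : nat) : nat := fst (proj1_sig (unpk_sig z)).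
Definition ps (z : nat) : nat := snd (proj1_sig (unpk_sig z)).

Lemma pk_pf_ps z : pk (pf z) (ps z) = z.
Proof. unfold pf, ps. now destruct (unpk_sig z). Qed.

Lemma pf_pk a b : pf (pk a b) = a.
Proof. apply (pk_inj _ (ps (pk a b)) _ b). apply pk_pf_ps. Qed.

Lemma ps_pk a b : ps (pk a b) = b.
Proof. apply (pk_inj (pf (pk a b)) _ a _). apply pk_pf_ps. Qed.

Lemma pk_ge_r a b : b <= pk a b.
Proof. pose proof (S_pk a b). pose proof (Nat.pow_nonzero 2 a). nia. Qed.

Lemma pk_ge_l a b : a <= pk a b.
Proof. pose proof (S_pk a b). pose proof (Nat.pow_gt_lin_r 2 a). nia. Qed.

(** * Counting *)

Fixpoint cnt (P : nat -> bool) (n : nat) : nat :=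
  match n with 0 => 0 | S m => Nat.b2n (P m) + cnt P m end.

Lemma cnt_ext_lt P Q n : (forall x, x < n -> P x = Q x) -> cnt P n = cnt Q n.
Proof.
  induction n as [|n IH]; intros H; [easy|]. simpl. rewrite IH, H; auto.
Qed.

Lemma cnt_sub P Q n : (forall x, x < n -> P x = true -> Q x = true) -> cnt P n <= cnt Q n.
Proof.
  induction n as [|n IH]; intros H; [easy|]. simpl.
  specialize (IH (fun x h => H x (Nat.lt_lt_succ_r _ _ h))).
  specialize (H n (Nat.lt_succ_diag_r n)).
  destruct (P n), (Q n); simpl; try lia.
Qed.

Lemma cnt_or P Q n : cnt (fun x => P x || Q x) n <= cnt P n + cnt Q n.
Proof. induction n; simpl; [lia|]. destruct (P n), (Q n); simpl; lia. Qed.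

Lemma cnt_negb P n : cnt P n + cnt (fun x => negb (P x)) n = n.
Proof. induction n; simpl; [lia|]. destruct (P n); simpl; lia. Qed.

Lemma cnt_le P n : cnt P n <= n.
Proof. pose proof (cnt_negb P n). lia. Qed.

Lemma cnt_mono P n m : n <= m -> cnt P n <= cnt P m.
Proof. induction 1; simpl; lia. Qed.

Lemma cnt_lt P n x : x < n -> P x = true -> cnt P x < cnt P n.
Proof.
  intros L H. apply Nat.lt_le_trans with (cnt P (S x)).
  - simpl. rewrite H. simpl. lia.
  - now apply cnt_mono.
Qed.

Lemma cnt_pos P n : cnt P n <> 0 <-> exists x, x < n /\ P x = true.
Proof.
  split.
  - induction n as [|n IH]; simpl; [easy|]. intros H.
    destruct (P n) eqn:E; [exists n; auto|].
    destruct IH as [x [L Hx]]; [simpl in H; lia|]. exists x; auto.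
  - intros [x [L H]]. pose proof (cnt_lt P n x L H). lia.
Qed.

(* Injections are allowed to be partial relations, so that no choice of images is needed. *)
Lemma cnt_inj_rel (R : nat -> nat -> Prop) P Q n m :
  (forall x, x < n -> P x = true -> exists y, y < m /\ Q y = true /\ R x y) ->
  (forall x x' y, R x y -> R x' y -> x = x') ->
  cnt P n <= cnt Q m.
Proof.
  intros H I. revert Q H. induction n as [|n IH]; intros Q H; simpl; [lia|].
  destruct (P n) eqn:E.
  - destruct (H n) as [y [L [Qy Ry]]]; auto.
    assert (cnt P n <= cnt (fun z => Q z && negb (z =? y)) m) as C.
    { apply IH. intros x Lx Px. destruct (H x) as [z [Lz [Qz Rz]]]; auto.
      exists z. repeat split; auto. rewrite Qz. simpl.
      destruct (Nat.eqb_spec z y) as [->|]; [|easy].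
      rewrite (I _ _ _ Ry Rz) in Lx. lia. }
    assert (forall k, cnt (fun z => Q z && negb (z =? y)) k + Nat.b2n (y <? k) <= cnt Q k) as D.
    { induction k as [|k IHk]; simpl; [easy|].
      destruct (Nat.eqb_spec k y) as [->|NE].
      - rewrite Qy. simpl. rewrite (proj2 (Nat.ltb_lt y (S y))) by lia.
        rewrite (proj2 (Nat.ltb_ge y y)) in IHk by lia. simpl in *. lia.
      - rewrite andb_true_r. destruct (Nat.ltb_spec y k), (Nat.ltb_spec y (S k));
        simpl in *; try lia. }
    specialize (D m). rewrite (proj2 (Nat.ltb_lt y m)) in D by lia. simpl in *. lia.
  - simpl. apply IH. intros x L. apply H. lia.
Qed.

Lemma cnt_interval P a b n :
  (forall x, P x = true -> a <= x < a + b) -> cnt P n <= b.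
Proof.
  (* Only the part of the interval below [n] is allowed for, a bound that the induction can
     maintain. *)
  intros H. assert (cnt P n <= Nat.min b (n - a)); [|lia].
  induction n as [|n IH]; cbn [cnt]; [lia|]. destruct (P n) eqn:E; cbn [Nat.b2n]; [|lia].
  apply H in E. lia.
Qed.

Lemma cnt_from P a b :
  (forall x, a <= x < a + b -> P x = true) -> b <= cnt P (a + b).
Proof.
  induction b as [|b IH]; intros H; [lia|]. rewrite Nat.add_succ_r. simpl.
  rewrite H by lia. simpl. pose proof (IH (fun x h => H x ltac:(lia))). lia.
Qed.

(** * Functions computed by programs *)

(** Only total functions of a fixed arity are covered; partial ones enter later, through
    minimisation. Nothing is asked of [f] on lists of other lengths. *)
Definition prc (k : nat) (f : list nat -> nat) : Prop :=
  exists e, forall xs, length xs = k -> ev e xs (f xs).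

Definition prcb (k : nat) (P : list nat -> bool) : Prop := prc k (fun xs => Nat.b2n (P xs)).

Lemma prc_ext k f g : (forall xs, length xs = k -> f xs = g xs) -> prc k f -> prc k g.
Proof. intros H [e He]. exists e. intros xs L. rewrite <- H; auto. Qed.

Lemma prc_nth k i : prc k (fun xs => nth i xs 0).
Proof. exists (PP i). intros xs _. constructor. Qed.

(** Under a bound variable the old environment appears as a tail; this turns references into it back
    into projections. *)
Lemma prc_nth_tl k i (f : list nat -> list nat) :
  prc k (fun xs => nth (S i) (f xs) 0) -> prc k (fun xs => nth i (tl (f xs)) 0).
Proof.
  apply prc_ext. intros xs _. destruct (f xs); [now destruct i | easy].
Qed.

Lemma prc_comp1 k (F : nat -> nat) a :
  prc 1 (fun xs => F (nth 0 xs 0)) -> prc k a -> prc k (fun xs => F (a xs)).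
Proof.
  intros [f Hf] [e He]. exists (PC f [e]). intros xs L.
  apply evC with [a xs]; [|now apply (Hf [a xs])].
  repeat constructor; auto.
Qed.

Lemma prc_comp2 k (F : nat -> nat -> nat) a b :
  prc 2 (fun xs => F (nth 0 xs 0) (nth 1 xs 0)) -> prc k a -> prc k b ->
  prc k (fun xs => F (a xs) (b xs)).
Proof.
  intros [f Hf] [e He] [e' He']. exists (PC f [e; e']). intros xs L.
  apply evC with [a xs; b xs]; [|now apply (Hf [a xs; b xs])].
  repeat constructor; auto.
Qed.

Lemma prc_comp3 k (F : nat -> nat -> nat -> nat) a b c :
  prc 3 (fun xs => F (nth 0 xs 0) (nth 1 xs 0) (nth 2 xs 0)) ->
  prc k a -> prc k b -> prc k c -> prc k (fun xs => F (a xs) (b xs) (c xs)).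
Proof.
  intros [f Hf] [e He] [e' He'] [e'' He'']. exists (PC f [e; e'; e'']). intros xs L.
  apply evC with [a xs; b xs; c xs]; [|now apply (Hf [a xs; b xs; c xs])].
  repeat constructor; auto.
Qed.

Lemma prc_S k a : prc k a -> prc k (fun xs => S (a xs)).
Proof. apply prc_comp1. exists PS. intros xs _. destruct xs; constructor. Qed.

Lemma prc_const k c : prc k (fun _ => c).
Proof.
  induction c; [exists PZ; constructor | now apply (prc_S k (fun _ => c))].
Qed.

Lemma evs_proj xs ys : evs (map PP (seq (length xs) (length ys))) (xs ++ ys) ys.
Proof.
  revert xs. induction ys as [|y ys IH]; intros xs; [constructor|].
  simpl. constructor.
  - replace y with (nth (length xs) (xs ++ y :: ys) 0) at 2; [constructor|].
    now rewrite app_nth2, Nat.sub_diag by lia.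
  - specialize (IH (xs ++ [y])). rewrite <- app_assoc, length_app, Nat.add_1_r in IH. exact IH.
Qed.

Lemma prc_rec k n b (g : nat -> nat -> list nat -> nat) :
  prc k n -> prc k b ->
  prc (S (S k)) (fun ys => g (nth 0 ys 0) (nth 1 ys 0) (tl (tl ys))) ->
  prc k (fun xs => nat_rect (fun _ => nat) (b xs) (fun i r => g i r xs) (n xs)).
Proof.
  intros [en Hn] [eb Hb] [eg Hg].
  exists (PC (PRec eb eg) (en :: map PP (seq 0 k))). intros xs L.
  apply evC with (n xs :: xs).
  - constructor; [auto|]. rewrite <- L. exact (evs_proj [] xs).
  - induction (n xs) as [|m IH]; simpl; [constructor; auto|].
    apply evRS with (1 := IH).
    refine (Hg (m :: _ :: xs) _). simpl. now rewrite L.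
Qed.

Lemma prc_add k a b : prc k a -> prc k b -> prc k (fun xs => a xs + b xs).
Proof.
  intros Ha Hb. eapply prc_ext; [|apply (prc_rec k a b (fun _ r _ => S r)); auto].
  - intros xs _. simpl. induction (a xs); simpl; lia.
  - apply prc_S, prc_nth.
Qed.

Lemma prc_mul k a b : prc k a -> prc k b -> prc k (fun xs => a xs * b xs).
Proof.
  apply (prc_comp2 k Nat.mul).
  eapply prc_ext; [|apply (prc_rec 2 (fun xs => nth 0 xs 0) (fun _ => 0)
    (fun _ r xs => nth 1 xs 0 + r))]; auto using prc_nth, prc_const.
  - intros xs _. simpl. induction (nth 0 xs 0); simpl; lia.
  - apply prc_add; repeat apply prc_nth_tl; apply prc_nth.
Qed.

Lemma prc_pred k a : prc k a -> prc k (fun xs => Nat.pred (a xs)).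
Proof.
  apply prc_comp1.
  eapply prc_ext; [|apply (prc_rec 1 (fun xs => nth 0 xs 0) (fun _ => 0)
    (fun i _ xs => i))]; auto using prc_nth, prc_const.
  intros xs _. simpl. now destruct (nth 0 xs 0).
Qed.

Lemma prc_sub k a b : prc k a -> prc k b -> prc k (fun xs => a xs - b xs).
Proof.
  apply (prc_comp2 k Nat.sub).
  eapply prc_ext; [|apply (prc_rec 2 (fun xs => nth 1 xs 0) (fun xs => nth 0 xs 0)
    (fun i r xs => Nat.pred r))]; auto using prc_nth, prc_const, prc_pred.
  intros xs _. simpl. induction (nth 1 xs 0); simpl; lia.
Qed.

Lemma prc_pow2 k a : prc k a -> prc k (fun xs => 2 ^ a xs).
Proof.
  intros Ha.
  eapply prc_ext; [|apply (prc_rec k a (fun _ => 1) (fun i r xs => r + r))];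
    auto using prc_nth, prc_const, prc_add.
  intros xs _. simpl. induction (a xs); simpl; lia.
Qed.

Lemma prc_ite k P a b : prcb k P -> prc k a -> prc k b ->
  prc k (fun xs => if P xs then a xs else b xs).
Proof.
  intros HP Ha Hb.
  eapply prc_ext; [|apply (prc_add k (fun xs => Nat.b2n (P xs) * a xs)
    (fun xs => (1 - Nat.b2n (P xs)) * b xs))];
  auto using prc_mul, prc_sub, prc_const.
  intros xs _. simpl. destruct (P xs); simpl; lia.
Qed.

Lemma prcb_ite k P (a b : list nat -> bool) : prcb k P -> prcb k a -> prcb k b ->
  prcb k (fun xs => if P xs then a xs else b xs).
Proof.
  intros HP Ha Hb.
  eapply prc_ext; [|exact (prc_ite _ _ _ _ HP Ha Hb)].
  intros xs _. simpl. now destruct (P xs).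
Qed.

Lemma prcb_true k : prcb k (fun _ => true).
Proof. exact (prc_const k 1). Qed.
Lemma prcb_false k : prcb k (fun _ => false).
Proof. exact (prc_const k 0). Qed.

Lemma prcb_and k P Q : prcb k P -> prcb k Q -> prcb k (fun xs => P xs && Q xs).
Proof. intros. apply prcb_ite; auto using prcb_false. Qed.

Lemma prcb_or k P Q : prcb k P -> prcb k Q -> prcb k (fun xs => P xs || Q xs).
Proof. intros. apply prcb_ite; auto using prcb_true. Qed.

Lemma prcb_neg k P : prcb k P -> prcb k (fun xs => negb (P xs)).
Proof. intros. apply prcb_ite; auto using prcb_true, prcb_false. Qed.

Lemma prcb_leb k a b : prc k a -> prc k b -> prcb k (fun xs => a xs <=? b xs).
Proof.
  intros Ha Hb.
  eapply prc_ext; [|apply (prc_sub k (fun _ => 1) (fun xs => a xs - b xs))];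
    auto using prc_sub, prc_const.
  intros xs _. destruct (Nat.leb_spec (a xs) (b xs)); simpl Nat.b2n; lia.
Qed.

Lemma prcb_ltb k a b : prc k a -> prc k b -> prcb k (fun xs => a xs <? b xs).
Proof. intros. apply (prcb_leb k (fun xs => S (a xs))); auto using prc_S. Qed.

Lemma prcb_eqb k a b : prc k a -> prc k b -> prcb k (fun xs => a xs =? b xs).
Proof.
  intros Ha Hb.
  eapply prc_ext; [|apply (prcb_and k (fun xs => a xs <=? b xs) (fun xs => b xs <=? a xs))];
    auto using prcb_leb.
  intros xs _. cbv beta. destruct (Nat.leb_spec (a xs) (b xs)), (Nat.leb_spec (b xs) (a xs)),
    (Nat.eqb_spec (a xs) (b xs)); simpl; lia.
Qed.

Lemma prc_cnt k n (P : nat -> list nat -> bool) :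
  prc k n -> prcb (S k) (fun ys => P (nth 0 ys 0) (tl ys)) ->
  prc k (fun xs => cnt (fun y => P y xs) (n xs)).
Proof.
  intros Hn [e He].
  eapply prc_ext; [|apply (prc_rec k n (fun _ => 0)
    (fun i r xs => Nat.b2n (P i xs) + r))]; auto using prc_const.
  - intros xs _. simpl. induction (n xs); simpl; congruence.
  - apply prc_add; [|apply prc_nth].
    (* The recursion supplies [i :: r :: xs] but the predicate expects [i :: xs], so the accumulator
       in position 1 is skipped. *)
    exists (PC e (map PP (0 :: seq 2 k))). intros [|i [|r xs]] L; try discriminate L.
    injection L as L.
    apply evC with (i :: xs); [|apply (He (i :: xs)); now simpl; rewrite L].
    simpl. constructor; [apply (evP 0)|]. rewrite <- L. exact (evs_proj [i; r] xs).
Qed.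

Definition bex (n : nat) (P : nat -> bool) : bool := negb (cnt P n =? 0).

Lemma bex_spec n P : bex n P = true <-> exists x, x < n /\ P x = true.
Proof. unfold bex. rewrite negb_true_iff, Nat.eqb_neq. apply cnt_pos. Qed.

Lemma prcb_bex k n (P : nat -> list nat -> bool) :
  prc k n -> prcb (S k) (fun ys => P (nth 0 ys 0) (tl ys)) ->
  prcb k (fun xs => bex (n xs) (fun y => P y xs)).
Proof.
  intros. unfold bex. apply prcb_neg, prcb_eqb; auto using prc_const, prc_cnt.
Qed.

(** Unbounded search succeeds because [f xs] is the only value satisfying the decidable graph; [G]
    is negated since [PMu] looks for 0. *)
Lemma prc_graph k f (G : nat -> list nat -> bool) :
  (forall xs y, G y xs = true <-> y = f xs) ->
  prcb (S k) (fun ys => G (nth 0 ys 0) (tl ys)) -> prc k f.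
Proof.
  intros H HG. apply prcb_neg in HG. destruct HG as [e He].
  exists (PMu e). intros xs L. constructor.
  - assert (E : Nat.b2n (negb (G (f xs) xs)) = 0)
      by now rewrite (proj2 (H xs (f xs)) eq_refl).
    rewrite <- E. apply (He (f xs :: xs)). now simpl; rewrite L.
  - intros m Lm. exists (Nat.b2n (negb (G m xs))). split.
    + destruct (G m xs) eqn:E; [|easy]. apply H in E. lia.
    + apply (He (m :: xs)). now simpl; rewrite L.
Qed.

Lemma prc_pk k a b : prc k a -> prc k b -> prc k (fun xs => pk (a xs) (b xs)).
Proof.
  intros Ha Hb. unfold pk.
  auto using prc_sub, prc_mul, prc_add, prc_pow2, prc_const.
Qed.

(** Extension point of [prc_one], redefined as further functions are shown computable. *)
Ltac prc_head := fail.
Ltac prc_one :=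
  first [assumption | lazymatch goal with
  | |- prc _ (fun xs => Nat.b2n (@?P xs)) => change (prcb _ P); cbv beta
  | |- prc ?k (fun _ => ?c) => apply (prc_const k c)
  | |- prc ?k (fun xs => nth ?i xs 0) => apply (prc_nth k i)
  | |- prc ?k (fun xs => nth ?i (tl (@?f xs)) 0) => apply (prc_nth_tl k i f)
  | |- prc ?k (fun xs => S (@?a xs)) => apply (prc_S k a)
  | |- prc ?k (fun xs => Nat.pred (@?a xs)) => apply (prc_pred k a)
  | |- prc ?k (fun xs => @?a xs + @?b xs) => apply (prc_add k a b)
  | |- prc ?k (fun xs => @?a xs * @?b xs) => apply (prc_mul k a b)
  | |- prc ?k (fun xs => @?a xs - @?b xs) => apply (prc_sub k a b)
  | |- prc ?k (fun xs => 2 ^ (@?a xs)) => apply (prc_pow2 k a)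
  | |- prc ?k (fun xs => if @?P xs then @?a xs else @?b xs) => apply (prc_ite k P a b)
  | |- prc ?k (fun xs => pk (@?a xs) (@?b xs)) => apply (prc_pk k a b)
  | |- prc ?k (fun xs => cnt (fun y => @?P xs y) (@?n xs)) =>
      apply (prc_cnt k n (fun y xs => P xs y))
  | |- prcb ?k (fun _ => true) => apply (prcb_true k)
  | |- prcb ?k (fun _ => false) => apply (prcb_false k)
  | |- prcb ?k (fun xs => @?P xs && @?Q xs) => apply (prcb_and k P Q)
  | |- prcb ?k (fun xs => @?P xs || @?Q xs) => apply (prcb_or k P Q)
  | |- prcb ?k (fun xs => negb (@?P xs)) => apply (prcb_neg k P)
  | |- prcb ?k (fun xs => @?a xs <=? @?b xs) => apply (prcb_leb k a b)
  | |- prcb ?k (fun xs => @?a xs <? @?b xs) => apply (prcb_ltb k a b)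
  | |- prcb ?k (fun xs => @?a xs =? @?b xs) => apply (prcb_eqb k a b)
  | |- prcb ?k (fun xs => if @?P xs then @?a xs else @?b xs) => apply (prcb_ite k P a b)
  | |- prcb ?k (fun xs => bex (@?n xs) (fun y => @?P xs y)) =>
      apply (prcb_bex k n (fun y xs => P xs y))
  | _ => prc_head
  end]; cbv beta.
Ltac prc_auto := repeat prc_one.

Lemma prc_pf k a : prc k a -> prc k (fun xs => pf (a xs)).
Proof.
  apply prc_comp1.
  apply prc_graph with
    (fun y xs => bex (S (nth 0 xs 0)) (fun b => pk y b =? nth 0 xs 0)).
  - intros xs y. rewrite bex_spec. split.
    + intros [b [_ E]]. apply Nat.eqb_eq in E. now rewrite <- E, pf_pk.
    + intros ->. exists (ps (nth 0 xs 0)). rewrite pk_pf_ps, Nat.eqb_refl. split; [|easy].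
      rewrite <- (pk_pf_ps (nth 0 xs 0)) at 2. pose proof (pk_ge_r (pf (nth 0 xs 0)) (ps (nth 0 xs 0))).
      lia.
  - prc_auto.
Qed.

Lemma prc_ps k a : prc k a -> prc k (fun xs => ps (a xs)).
Proof.
  apply prc_comp1.
  apply prc_graph with
    (fun y xs => bex (S (nth 0 xs 0)) (fun b => pk b y =? nth 0 xs 0)).
  - intros xs y. rewrite bex_spec. split.
    + intros [b [_ E]]. apply Nat.eqb_eq in E. now rewrite <- E, ps_pk.
    + intros ->. exists (pf (nth 0 xs 0)). rewrite pk_pf_ps, Nat.eqb_refl. split; [|easy].
      rewrite <- (pk_pf_ps (nth 0 xs 0)) at 2.
      pose proof (pk_ge_l (pf (nth 0 xs 0)) (ps (nth 0 xs 0))). lia.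
  - prc_auto.
Qed.

Lemma prc_log2 k a : prc k a -> prc k (fun xs => Nat.log2 (a xs)).
Proof.
  apply prc_comp1.
  apply prc_graph with (fun y xs =>
    if nth 0 xs 0 =? 0 then y =? 0 else (2 ^ y <=? nth 0 xs 0) && (nth 0 xs 0 <? 2 ^ S y)).
  - intros xs y. destruct (Nat.eqb_spec (nth 0 xs 0) 0) as [->|NE]; [apply Nat.eqb_eq|].
    rewrite andb_true_iff, Nat.leb_le, Nat.ltb_lt. split.
    + intros. symmetry. apply Nat.log2_unique; lia.
    + intros ->. apply Nat.log2_spec. lia.
  - prc_auto.
Qed.

Ltac prc_head ::=
  lazymatch goal with
  | |- prc ?k (fun xs => pf (@?a xs)) => apply (prc_pf k a)
  | |- prc ?k (fun xs => ps (@?a xs)) => apply (prc_ps k a)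
  | |- prc ?k (fun xs => Nat.log2 (@?a xs)) => apply (prc_log2 k a)
  end.

(** * An abstract machine running all programs *)

(* Since [pk 0 0 = 0], the code [0] of the empty list has head and tail [0], like [hd 0] and [nth]. *)
Definition cs (a l : nat) : nat := S (pk a l).
Definition chd (l : nat) : nat := pf (pred l).
Definition ctl (l : nat) : nat := ps (pred l).

Fixpoint cl (l : list nat) : nat :=
  match l with [] => 0 | a :: l' => cs a (cl l') end.

Lemma pf_0 : pf 0 = 0.
Proof. exact (pf_pk 0 0). Qed.
Lemma ps_0 : ps 0 = 0.
Proof. exact (ps_pk 0 0). Qed.
Lemma chd_cs a l : chd (cs a l) = a.
Proof. apply pf_pk. Qed.
Lemma ctl_cs a l : ctl (cs a l) = l.
Proof. apply ps_pk. Qed.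
Lemma chd_cl l : chd (cl l) = hd 0 l.
Proof. destruct l; [exact pf_0 | apply chd_cs]. Qed.
Lemma ctl_cl l : ctl (cl l) = cl (tl l).
Proof. destruct l; [exact ps_0 | apply ctl_cs]. Qed.

(* The arguments [gs] are stored in reverse, because the machine conses each value onto those
   computed before. *)
Fixpoint enc (e : PR) : nat :=
  match e with
  | PZ => pk 0 0
  | PS => pk 1 0
  | PP i => pk 2 i
  | PC f gs => pk 3 (pk (enc f) (cl (rev (map enc gs))))
  | PRec f g => pk 4 (pk (enc f) (enc g))
  | PMu f => pk 5 (enc f)
  end.

(* [EV c x K]: evaluate the program coded by [c] on the environment coded by [x], then pass the
   value to the stack [K] of pending frames; [RT y K]: the value [y] is being passed to [K]. *)
Definition EV (c x K : nat) : nat := pk 0 (pk c (pk x K)).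
Definition RT (y K : nat) : nat := pk 1 (pk y K).

Definition args (f gs x ys K : nat) : nat :=
  if gs =? 0 then EV f ys K
  else EV (chd gs) x (cs (pk 0 (pk f (pk (ctl gs) (pk x ys)))) K).

(* A recursion on the empty environment has no value: the machine loops there. *)
Definition step_ev (s c x K : nat) : nat :=
  if pf c =? 0 then RT 0 K
  else if pf c =? 1 then RT (S (chd x)) K
  else if pf c =? 2 then
    if ps c =? 0 then RT (chd x) K else EV (pk 2 (pred (ps c))) (ctl x) K
  else if pf c =? 3 then args (pf (ps c)) (ps (ps c)) x 0 K
  else if pf c =? 4 then
    if x =? 0 then s
    else if chd x =? 0 then EV (pf (ps c)) (ctl x) K
    else EV c (cs (pred (chd x)) (ctl x))
           (cs (pk 1 (pk (ps (ps c)) (pk (pred (chd x)) (ctl x)))) K)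
  else EV (ps c) (cs 0 x) (cs (pk 2 (pk (ps c) (pk 0 x))) K).

(** The tags 0, 1 and 2 belong to frames left by a composition, a recursion and a minimisation; [p],
    [q], [r] are the data saved in the frame. *)
Definition step_rt (y tag p q r K : nat) : nat :=
  if tag =? 0 then args p q (pf r) (cs y (ps r)) K
  else if tag =? 1 then EV p (cs q (cs y r)) K
  else if y =? 0 then RT q K
  else EV p (cs (S q) r) (cs (pk 2 (pk p (pk (S q) r))) K).

Definition step (s : nat) : nat :=
  if pf s =? 0 then step_ev s (pf (ps s)) (pf (ps (ps s))) (ps (ps (ps s)))
  else if ps (ps s) =? 0 then s
  else step_rt (pf (ps s)) (pf (chd (ps (ps s)))) (pf (ps (chd (ps (ps s)))))
         (pf (ps (ps (chd (ps (ps s)))))) (ps (ps (ps (chd (ps (ps s))))))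
         (ctl (ps (ps s))).

(* [T c x n] is [0] if program [c] has not halted on [x] after [n] steps, and [S y] if it has
   with value [y]. *)
Definition T (c x n : nat) : nat :=
  let s := Nat.iter n step (EV c (cs x 0) 0) in
  if (pf s =? 1) && (ps (ps s) =? 0) then S (pf (ps s)) else 0.

Lemma prc_step k a : prc k a -> prc k (fun xs => step (a xs)).
Proof.
  apply prc_comp1. unfold step, step_ev, step_rt, args, EV, RT, chd, ctl, cs. prc_auto.
Qed.

Lemma prc_T k a b c : prc k a -> prc k b -> prc k c -> prc k (fun xs => T (a xs) (b xs) (c xs)).
Proof.
  apply prc_comp3.
  assert (prc 3 (fun xs => Nat.iter (nth 2 xs 0) step
    (EV (nth 0 xs 0) (cs (nth 1 xs 0) 0) 0))) as HI.
  { apply (prc_rec 3 (fun xs => nth 2 xs 0) (fun xs => EV (nth 0 xs 0) (cs (nth 1 xs 0) 0) 0)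
      (fun _ r _ => step r)); [prc_auto | unfold EV, cs; prc_auto | apply prc_step, prc_nth]. }
  unfold T. cbv zeta. prc_auto.
Qed.
Ltac prc_head ::=
  lazymatch goal with
  | |- prc ?k (fun xs => pf (@?a xs)) => apply (prc_pf k a)
  | |- prc ?k (fun xs => ps (@?a xs)) => apply (prc_ps k a)
  | |- prc ?k (fun xs => Nat.log2 (@?a xs)) => apply (prc_log2 k a)
  | |- prc ?k (fun xs => T (@?a xs) (@?b xs) (@?c xs)) => apply (prc_T k a b c)
  end.

Ltac pks := repeat rewrite ?pf_pk, ?ps_pk, ?chd_cs, ?ctl_cs, ?chd_cl, ?ctl_cl, ?Nat.eqb_refl.

Ltac pks_in H := repeat rewrite ?pf_pk, ?ps_pk, ?chd_cs, ?ctl_cs, ?chd_cl, ?ctl_cl, ?Nat.eqb_refl in H.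

Lemma step_RT_cs y tag p q r K :
  step (RT y (cs (pk tag (pk p (pk q r))) K)) = step_rt y tag p q r K.
Proof. unfold step, RT. pks. reflexivity. Qed.

Lemma step_EV c x K : step (EV c x K) = step_ev (EV c x K) c x K.
Proof. unfold step, EV. pks. reflexivity. Qed.

Lemma step_RT_0 y : step (RT y 0) = RT y 0.
Proof. unfold step, RT. now pks. Qed.

Definition reach (s s' : nat) : Prop := exists n, Nat.iter n step s = s'.

Lemma reach_refl s : reach s s.
Proof. now exists 0. Qed.

Lemma reach_trans s s' s'' : reach s s' -> reach s' s'' -> reach s s''.
Proof. intros [n <-] [m <-]. exists (m + n). apply Nat.iter_add. Qed.

Lemma reach_step s s' : reach (step s) s' -> reach s s'.
Proof. apply reach_trans. now exists 1. Qed.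

(* The automatic induction principle ignores the arguments of [PC]. *)
Fixpoint PR_nested_ind (P : PR -> Prop) (hZ : P PZ) (hS : P PS) (hP : forall i, P (PP i))
  (hC : forall f gs, P f -> List.Forall P gs -> P (PC f gs))
  (hR : forall f g, P f -> P g -> P (PRec f g)) (hM : forall f, P f -> P (PMu f))
  (e : PR) : P e :=
  let F := PR_nested_ind P hZ hS hP hC hR hM in
  match e with
  | PZ => hZ | PS => hS | PP i => hP i
  | PC f gs => hC f gs (F f)
      ((fix G l : List.Forall P l := match l with
        | [] => Forall_nil P | g :: l' => Forall_cons g (F g) (G l') end) gs)
  | PRec f g => hR f g (F f) (F g)
  | PMu f => hM f (F f)
  end.

Lemma reach_args (gs : list PR) xs ys :
  List.Forall (fun g => forall xs y K, ev g xs y -> reach (EV (enc g) (cl xs) K) (RT y K)) gs ->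
  evs gs xs ys -> forall f acc rest K,
  reach (args f (cl (rev (map enc gs) ++ rest)) (cl xs) (cl acc) K)
        (args f (cl rest) (cl xs) (cl (ys ++ acc)) K).
Proof.
  intros F E. revert F. induction E as [xs|g gs xs y ys Eg Es IH]; intros F f acc rest K.
  - apply reach_refl.
  - inversion_clear F as [|? ? Hg Hgs]. simpl. rewrite <- app_assoc.
    eapply reach_trans; [now apply IH|].
    unfold args at 1. simpl. pks.
    eapply reach_trans; [exact (Hg _ _ _ Eg)|]. apply reach_step.
    rewrite step_RT_cs. unfold step_rt. simpl. pks. apply reach_refl.
Qed.

Lemma reach_ev e xs y K : ev e xs y -> reach (EV (enc e) (cl xs) K) (RT y K).
Proof.
  revert xs y K. induction e as [| |i|f gs IHf IHgs|f g IHf IHg|f IHf] using PR_nested_ind;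
    intros xs y K E.
  - inversion_clear E. apply reach_step. rewrite step_EV. unfold step_ev. simpl. pks. apply reach_refl.
  - inversion_clear E. apply reach_step. rewrite step_EV. unfold step_ev. simpl. pks. apply reach_refl.
  - inversion_clear E. simpl. revert xs. induction i as [|i IH]; intros xs;
      apply reach_step; rewrite step_EV; unfold step_ev; pks; simpl.
    + destruct xs; apply reach_refl.
    + destruct xs as [|a xs]; [|apply IH].
      specialize (IH []). now destruct i.
  - inversion_clear E as [| | |? ? ? ys ? Es Ef | | | ]. apply reach_step. rewrite step_EV. unfold step_ev. simpl.
    pks. simpl. pose proof (reach_args gs xs ys IHgs Es (enc f) [] [] K) as H.
    rewrite !app_nil_r in H. eapply reach_trans; [exact H|]. now apply IHf.
  - destruct xs as [|n xs]; [inversion E|]. revert y K E.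
    induction n as [|n IH]; intros y K E; inversion_clear E as [| | | |? ? ? ? Ef |? ? ? ? r ? Er Eg | ];
      apply reach_step; rewrite step_EV; unfold step_ev; simpl; pks; simpl.
    + now apply IHf.
    + eapply reach_trans; [exact (IH _ _ Er)|].
      apply reach_step. rewrite step_RT_cs. unfold step_rt. simpl.
      now apply (IHg (n :: r :: xs)).
  - inversion_clear E as [| | | | | |? ? ? E0 Em].
    apply reach_step. rewrite step_EV. unfold step_ev. simpl. pks. simpl.
    (* The run passes through every candidate up to [y], since each smaller one returns a nonzero
       value. *)
    assert (forall i, i <= y -> reach (EV (enc f) (cl (0 :: xs)) (cs (pk 2 (pk (enc f) (pk 0 (cl xs)))) K))
      (EV (enc f) (cl (i :: xs)) (cs (pk 2 (pk (enc f) (pk i (cl xs)))) K))) as L.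
    { induction i as [|i IH]; intros Li; [apply reach_refl|].
      eapply reach_trans; [apply IH; lia|].
      destruct (Em i Li) as [[|k] [Nk Ek]]; [easy|].
      eapply reach_trans; [apply (IHf _ _ _ Ek)|].
      apply reach_step. rewrite step_RT_cs. unfold step_rt. simpl. apply reach_refl. }
    eapply reach_trans; [apply (L y); lia|].
    eapply reach_trans; [apply (IHf _ _ _ E0)|].
    apply reach_step. rewrite step_RT_cs. unfold step_rt. simpl. apply reach_refl.
Qed.

Definition halts_in (n s : nat) : Prop := exists y, Nat.iter n step s = RT y 0.

Lemma iter_fixed n s : step s = s -> Nat.iter n step s = s.
Proof. intros H. induction n as [|n IH]; simpl; [easy|]. now rewrite IH. Qed.

Lemma iter_RT_0 n y : Nat.iter n step (RT y 0) = RT y 0.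
Proof. apply iter_fixed, step_RT_0. Qed.

(** Both derivations are followed by the same deterministic run from an empty stack, and a final
    state never changes. *)
Lemma ev_det e xs y z : ev e xs y -> ev e xs z -> y = z.
Proof.
  intros Hy Hz. destruct (reach_ev e xs y 0 Hy) as [n En], (reach_ev e xs z 0 Hz) as [m Em].
  assert (RT y 0 = RT z 0) as E.
  { rewrite <- (iter_RT_0 m y), <- (iter_RT_0 n z), <- En, <- Em, <- !Nat.iter_add.
    f_equal. lia. }
  now apply pk_inj in E as [_ E%pk_inj].
Qed.

Lemma halts_in_after n m s s' :
  halts_in n s -> Nat.iter m step s = s' -> halts_in (n - m) s'.
Proof.
  intros [y H] <-. exists y. destruct (Nat.le_gt_cases m n).
  - rewrite <- Nat.iter_add. now replace (n - m + m) with n by lia.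
  - replace m with ((m - n) + n) by lia. rewrite Nat.iter_add, H.
    now rewrite !iter_RT_0.
Qed.

Lemma halts_in_reach n s s' : halts_in n s -> reach s s' -> exists m, m <= n /\ halts_in m s'.
Proof.
  intros H [m E]. exists (n - m). split; [lia | now apply halts_in_after with (2 := E)].
Qed.

Lemma halts_in_step n s : halts_in n s -> halts_in (n - 1) (step s).
Proof. intros H. now apply halts_in_after with (1 := H). Qed.

Lemma EV_not_RT c x K y K' : EV c x K <> RT y K'.
Proof. intros H. now apply pk_inj in H. Qed.

(** Halting of the whole run, below an arbitrary stack [K], is inherited by all later states, so no
    notion of a return to [K] is required. That the machine computes the right value is then a
    matter of [reach_ev]. *)
Definition sound (e : PR) : Prop := forall xs K n, halts_in n (EV (enc e) (cl xs) K) ->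
  exists y, ev e xs y.

(** Once the tail is known to have values, [reach_args] moves the run to the start of [g], where
    halting is inherited and [sound] applies. *)
Lemma halts_args gs xs : List.Forall sound gs -> forall f acc rest K n,
  halts_in n (args f (cl (rev (map enc gs) ++ rest)) (cl xs) (cl acc) K) ->
  exists ys, evs gs xs ys.
Proof.
  induction 1 as [|g gs Hg Hgs IH]; intros f acc rest K n H; [exists []; constructor|].
  simpl in H. rewrite <- app_assoc in H.
  destruct (IH _ _ _ _ _ H) as [ys Es].
  destruct (halts_in_reach _ _ _ H (reach_args gs xs ys (proj2 (Forall_forall _ _)
    (fun g _ xs y K => reach_ev g xs y K)) Es f acc (rev (map enc [g]) ++ rest) K)) as [m [_ Hm]].
  simpl in Hm. unfold args in Hm at 1. simpl in Hm. rewrite chd_cs, ctl_cs in Hm.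
  destruct (Hg _ _ _ Hm) as [y Ey]. exists (y :: ys). now constructor.
Qed.

Lemma sound_rec f g : sound f -> sound g -> sound (PRec f g).
Proof.
  intros IHf IHg [|n xs].
  - intros K N [y H]. exfalso.
    assert (step (EV (enc (PRec f g)) (cl []) K) = EV (enc (PRec f g)) (cl []) K) as F.
    { rewrite step_EV. unfold step_ev. simpl. now pks. }
    apply (EV_not_RT (enc (PRec f g)) (cl []) K y 0). rewrite <- H. symmetry. now apply iter_fixed.
  - induction n as [|n IH]; intros K N H;
      apply halts_in_step in H; rewrite step_EV in H; unfold step_ev in H; simpl in H;
      pks_in H; simpl in H.
    + destruct (IHf _ _ _ H) as [y Ef]. exists y. now constructor.
    + destruct (IH _ _ H) as [r Er].
      destruct (halts_in_reach _ _ _ H (reach_ev (PRec f g) (n :: xs) r _ Er)) as [m [_ Hm]].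
      apply halts_in_step in Hm. rewrite step_RT_cs in Hm.
      destruct (IHg (n :: r :: xs) _ _ Hm) as [y Eg]. exists y. now apply evRS with r.
Qed.

Lemma sound_all e : sound e.
Proof.
  induction e as [| |i|f gs IHf IHgs|f g IHf IHg|f IHf] using PR_nested_ind;
    intros xs K N H.
  - exists 0. constructor.
  - eexists. constructor.
  - eexists. constructor.
  - apply halts_in_step in H. rewrite step_EV in H. unfold step_ev in H.
    cbn [enc] in H. pks_in H. cbn [Nat.eqb] in H.
    pose proof (halts_args gs xs IHgs (enc f) [] [] K) as HA. rewrite app_nil_r in HA.
    destruct (HA _ H) as [ys Es].
    pose proof (reach_args gs xs ys (proj2 (Forall_forall _ _)
      (fun g _ xs y K => reach_ev g xs y K)) Es (enc f) [] [] K) as R.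
    rewrite !app_nil_r in R. destruct (halts_in_reach _ _ _ H R) as [m [_ Hm]].
    destruct (IHf _ _ _ Hm) as [y Ef]. exists y. now apply evC with ys.
  - exact (sound_rec f g IHf IHg xs K N H).
  - apply halts_in_step in H. rewrite step_EV in H. unfold step_ev in H.
    cbn [enc] in H. pks_in H. cbn [Nat.eqb] in H.
    (* The candidates have no bound known in advance, so the induction is on the number [M] of steps
       within which the run halts; every rejected candidate uses some up. *)
    assert (forall M i, (forall m, m < i -> exists k, k <> 0 /\ ev f (m :: xs) k) ->
      halts_in M (EV (enc f) (cl (i :: xs)) (cs (pk 2 (pk (enc f) (pk i (cl xs)))) K)) ->
      exists y, ev (PMu f) xs y) as L; [|apply (L _ 0 ltac:(lia) H)].
    clear N H. induction M as [M IH] using lt_wf_ind. intros i Hi H.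
    destruct (IHf _ _ _ H) as [v Ev].
    destruct v as [|v]; [exists i; now constructor|].
    destruct (reach_ev f (i :: xs) (S v) (cs (pk 2 (pk (enc f) (pk i (cl xs)))) K) Ev) as [n En].
    assert (M <> 0) by (intros ->; destruct H as [? H]; now apply EV_not_RT in H).
    assert (n <> 0) by (intros ->; now apply EV_not_RT in En).
    apply (IH (M - n - 1)) with (i := S i); [lia| |].
    + intros m Lm. destruct (Nat.eq_dec m i) as [->|]; [exists (S v); auto|]. apply Hi. lia.
    + pose proof (halts_in_step _ _ (halts_in_after _ _ _ _ H En)) as H'.
      rewrite step_RT_cs in H'. exact H'.
Qed.

Lemma T_stable c x n m y : T c x n = S y -> n <= m -> T c x m = S y.
Proof.
  unfold T. set (s := EV c (cs x 0) 0). cbv zeta. intros H L.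
  replace m with ((m - n) + n) by lia. rewrite Nat.iter_add.
  destruct (Nat.eqb_spec (pf (Nat.iter n step s)) 1) as [E1|]; [|easy].
  destruct (Nat.eqb_spec (ps (ps (Nat.iter n step s))) 0) as [E2|]; [|easy].
  simpl in H. injection H as H.
  assert (Nat.iter n step s = RT y 0) as ->.
  { unfold RT. now rewrite <- H, <- E1, <- E2, !pk_pf_ps. }
  rewrite iter_RT_0. unfold RT. pks. reflexivity.
Qed.

Lemma T_spec e x y : ev e [x] y <-> exists n, T (enc e) x n = S y.
Proof.
  assert (forall z, ev e [x] z -> exists n, T (enc e) x n = S z) as F.
  { intros z H. destruct (reach_ev e [x] z 0 H) as [n E]. exists n.
    unfold T. simpl in E. rewrite E. unfold RT. pks. reflexivity. }
  split; [apply F|]. intros [n H].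
  assert (halts_in n (EV (enc e) (cl [x]) 0)) as HH.
  { unfold T in H. cbv zeta in H. change (cs x 0) with (cl [x]) in H. unfold halts_in.
    revert H. generalize (Nat.iter n step (EV (enc e) (cl [x]) 0)). intros s H. exists (pf (ps s)).
    destruct (Nat.eqb_spec (pf s) 1) as [E1|]; [|easy].
    destruct (Nat.eqb_spec (ps (ps s)) 0) as [E2|]; [|easy].
    rewrite <- (pk_pf_ps s) at 1. rewrite E1. unfold RT. f_equal.
    rewrite <- E2 at 1. now rewrite pk_pf_ps. }
  destruct (sound_all e _ _ _ HH) as [z Ez]. destruct (F z Ez) as [m Hm].
  assert (S y = S z) as Eyz.
  { rewrite <- (T_stable _ _ _ (n + m) _ H), <- (T_stable _ _ _ (n + m) _ Hm); lia. }
  injection Eyz as ->. exact Ez.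
Qed.

Lemma ev_mu (G : nat -> nat -> bool) (r : nat -> nat -> nat) :
  prcb 2 (fun xs => G (nth 0 xs 0) (nth 1 xs 0)) ->
  prc 2 (fun xs => r (nth 0 xs 0) (nth 1 xs 0)) ->
  exists e, forall x y, ev e [x] y <->
    exists t, G t x = true /\ (forall u, u < t -> G u x = false) /\ y = r t x.
Proof.
  intros HG [er Hr]. apply prcb_neg in HG. destruct HG as [eg Hg].
  exists (PC er [PMu eg; PP 0]). intros x y.
  assert (forall t x z, ev eg [t; x] z -> z = Nat.b2n (negb (G t x))) as Dg.
  { intros t u z E. exact (ev_det _ _ _ _ E (Hg [t; u] eq_refl)). }
  assert (forall t x z, ev er [t; x] z -> z = r t x) as Dr.
  { intros t u z E. exact (ev_det _ _ _ _ E (Hr [t; u] eq_refl)). }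
  split.
  - intros E. inversion_clear E as [| | |? ? ? ys ? Es Er | | | ].
    inversion Es as [|? ? ? t ? Et Ex]; subst. inversion Ex as [|? ? ? z ? Ez En]; subst.
    inversion En; subst. inversion Ez; subst. simpl in *.
    inversion_clear Et as [| | | | | |? ? ? E0 Em].
    exists t. apply Dg in E0. repeat split; [| |now apply Dr].
    + now destruct (G t x).
    + intros u Lu. destruct (Em u Lu) as [k [Nk Ek]]. apply Dg in Ek. now destruct (G u x); subst.
  - intros [t [Gt [Gu ->]]]. apply evC with [t; x]; [|now apply (Hr [t; x])].
    repeat constructor.
    + pose proof (Hg [t; x] eq_refl) as E. simpl in E. now rewrite Gt in E.
    + intros u Lu. exists 1. split; [easy|]. pose proof (Hg [u; x] eq_refl) as E. simpl in E.
      now rewrite (Gu u Lu) in E.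
Qed.

(** * Strings as numbers *)

Definition num_from (a : nat) (s : bstr) : nat :=
  fold_left (fun acc (b : bool) => 2 * acc + (if b then 1 else 0)) s a.

Lemma num_from_bounds s a :
  a * 2 ^ length s <= num_from a s < S a * 2 ^ length s.
Proof.
  unfold num_from. revert a. induction s as [|b s IH]; intros a; cbn [fold_left length].
  - simpl. lia.
  - specialize (IH (2 * a + (if b then 1 else 0))). rewrite Nat.pow_succ_r'. destruct b; nia.
Qed.

Lemma num_from_inj s s' a a' :
  length s = length s' -> num_from a s = num_from a' s' -> a = a' /\ s = s'.
Proof.
  unfold num_from. revert s' a a'.
  induction s as [|b s IH]; intros [|b' s'] a a' L E; try discriminate L; [easy|].
  injection L as L. apply (IH s') in E; [|easy]. destruct E as [E ->].
  destruct b, b'; split; try lia; f_equal; lia.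
Qed.

(** At the first differing bit, the disjoint intervals of [num_from_bounds] separate the two
    numbers, whatever bits follow. *)
Lemma lex_le_num_from x y a :
  length x = length y -> (lex_le x y <-> num_from a x <= num_from a y).
Proof.
  revert y a. induction x as [|b x IH]; intros [|b' y] a L; try discriminate L; [simpl; lia|].
  injection L as L. cbn [lex_le].
  change (num_from a (b :: x)) with (num_from (2 * a + if b then 1 else 0) x).
  change (num_from a (b' :: y)) with (num_from (2 * a + if b' then 1 else 0) y).
  pose proof (num_from_bounds x (2 * a + if b then 1 else 0)) as Bx.
  pose proof (num_from_bounds y (2 * a + if b' then 1 else 0)) as By.
  rewrite L in Bx.
  destruct b, b'; rewrite <- ?IH by easy; intuition (try easy; try nia).
Qed.

Lemma S_code s : S (code s) = num_from 1 s.
Proof.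
  pose proof (num_from_bounds s 1). pose proof (Nat.pow_nonzero 2 (length s)).
  unfold code. change (Defs.num s) with (num_from 1 s). lia.
Qed.

Lemma code_bounds s : 2 ^ length s <= S (code s) < 2 ^ S (length s).
Proof. rewrite S_code, Nat.pow_succ_r'. pose proof (num_from_bounds s 1). lia. Qed.

Lemma log2_code s : Nat.log2 (S (code s)) = length s.
Proof. apply Nat.log2_unique; [lia | apply code_bounds]. Qed.

Lemma code_inj s s' : code s = code s' -> s = s'.
Proof.
  intros E. apply (num_from_inj s s' 1 1).
  - now rewrite <- !log2_code, E.
  - now rewrite <- !S_code, E.
Qed.

(** The number of strings of length at most [n]; their codes are exactly the numbers below it. *)
Definition nstr (n : nat) : nat := 2 ^ S n - 1.

Lemma map_num_from_strs_len n a :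
  map (num_from a) (strs_len n) = seq (a * 2 ^ n) (2 ^ n).
Proof.
  revert a. induction n as [|n IH]; intros a; [simpl; now rewrite Nat.mul_1_r|].
  cbn [strs_len]. rewrite map_app, !map_map, Nat.pow_succ_r'.
  change (fun x => num_from a (false :: x)) with (num_from (2 * a + 0)).
  change (fun x => num_from a (true :: x)) with (num_from (2 * a + 1)).
  rewrite !IH. replace (2 * 2 ^ n) with (2 ^ n + 2 ^ n) by lia.
  rewrite seq_app. f_equal; f_equal; lia.
Qed.

Lemma map_code_strs_upto n : map (A:=bstr) code (strs_upto n) = seq 0 (nstr n).
Proof.
  induction n as [|n IH]; [reflexivity|].
  unfold strs_upto in *. rewrite (seq_S (S n) 0), flat_map_app, map_app, IH. cbn [flat_map].
  rewrite app_nil_r, Nat.add_0_l.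
  replace (map (A:=bstr) code (strs_len (S n))) with (map pred (map (num_from 1) (strs_len (S n)))).
  - rewrite map_num_from_strs_len, Nat.mul_1_l.
    replace (nstr (S n)) with (nstr n + 2 ^ S n).
    + rewrite seq_app. f_equal. unfold nstr. rewrite Nat.add_0_l.
      pose proof (Nat.pow_nonzero 2 (S n) ltac:(lia)) as NZ.
      replace (seq (2 ^ S n) (2 ^ S n)) with (seq (S (2 ^ S n - 1)) (2 ^ S n)) by (f_equal; lia).
      rewrite <- seq_shift, map_map. apply map_id.
    + unfold nstr. pose proof (Nat.pow_nonzero 2 (S n)). rewrite (Nat.pow_succ_r' 2 (S n)). lia.
  - rewrite map_map. apply map_ext. intros s. now rewrite <- S_code.
Qed.

Lemma decode_sig k : {s : bstr | code s = k}.
Proof.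
  apply constructive_indefinite_description.
  assert (In k (map (A:=bstr) code (strs_upto k))) as H.
  { rewrite map_code_strs_upto. apply in_seq. unfold nstr.
    pose proof (Nat.pow_gt_lin_r 2 (S k)). lia. }
  apply in_map_iff in H. firstorder.
Qed.

Definition decode (k : nat) : bstr := proj1_sig (decode_sig k).

Lemma code_decode k : code (decode k) = k.
Proof. unfold decode. now destruct (decode_sig k). Qed.

Lemma decode_code s : decode (code s) = s.
Proof. apply code_inj, code_decode. Qed.

Lemma code_lex_le x y : length x = length y -> code x <= code y -> lex_le x y.
Proof. intros L H. apply (lex_le_num_from x y 1 L). rewrite <- !S_code. lia. Qed.

(** * Error fractions as counts, and their lower and upper limits *)

Lemma length_filter_seq P n : length (filter P (seq 0 n)) = cnt P n.
Proof.
  induction n as [|n IH]; [easy|]. rewrite seq_S, filter_app, length_app, IH. simpl.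
  destruct (P n); simpl; lia.
Qed.

Lemma length_filter_map {A B} (f : A -> B) P l :
  length (filter P (map f l)) = length (filter (fun x => P (f x)) l).
Proof. induction l as [|a l IH]; simpl; [easy|]. destruct (P (f a)); simpl; congruence. Qed.

Lemma decP_true P : decP P = true <-> P.
Proof. unfold decP. destruct (excluded_middle_informative P); easy. Qed.

Definition err (U A : pfun) (k : nat) : bool := decP (errs U A (decode k)).

Lemma eps_n_cnt U A n :
  eps_n U A n = (INR (cnt (err U A) (nstr n)) / INR (nstr n))%R.
Proof.
  unfold eps_n. f_equal; [|f_equal]; f_equal.
  - rewrite <- length_filter_seq, <- map_code_strs_upto, length_filter_map.
    f_equal. apply filter_ext. intros s. unfold err. now rewrite decode_code.
  - now rewrite <- (length_map code), map_code_strs_upto, length_seq.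
Qed.

Lemma nstr_pos n : 0 < nstr n.
Proof. unfold nstr. pose proof (Nat.pow_gt_lin_r 2 (S n)). lia. Qed.

Lemma eps_n_ge U A n d :
  nstr n <= d * cnt (err U A) (nstr n) -> (/ INR d <= eps_n U A n)%R.
Proof.
  intros H. pose proof (nstr_pos n) as P. rewrite eps_n_cnt.
  assert (0 < d) as Pd by nia.
  apply lt_INR in P, Pd. simpl in P, Pd. apply le_INR in H. rewrite mult_INR in H.
  apply Rmult_le_reg_l with (INR d); [easy|]. apply Rmult_le_reg_r with (INR (nstr n)); [easy|].
  rewrite Rinv_r by lra.
  replace (INR d * (INR (cnt (err U A) (nstr n)) / INR (nstr n)) * INR (nstr n))%R
    with (INR d * INR (cnt (err U A) (nstr n)))%R; [lra|]. field. lra.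
Qed.

Lemma eps_n_le U A n d :
  0 < d -> d * cnt (err U A) (nstr n) <= nstr n -> (eps_n U A n <= / INR d)%R.
Proof.
  intros Pd H. pose proof (nstr_pos n) as P. rewrite eps_n_cnt.
  apply lt_INR in P, Pd. simpl in P, Pd. apply le_INR in H. rewrite mult_INR in H.
  apply Rmult_le_reg_l with (INR d); [easy|]. apply Rmult_le_reg_r with (INR (nstr n)); [easy|].
  rewrite Rinv_r by lra.
  replace (INR d * (INR (cnt (err U A) (nstr n)) / INR (nstr n)) * INR (nstr n))%R
    with (INR d * INR (cnt (err U A) (nstr n)))%R; [lra|]. field. lra.
Qed.

Lemma LimInf_seq_ge (u : nat -> R) d N :
  (forall n, N <= n -> (d <= u n)%R) -> Rbar_le (Finite d) (LimInf_seq u).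
Proof.
  intros H. unfold LimInf_seq. destruct (ex_LimInf_seq u) as [[l| |] Hl]; simpl in *; auto.
  - destruct (Rle_lt_dec d l) as [|L]; [easy|].
    destruct (Hl (mkposreal (d - l) ltac:(lra))) as [F _].
    destruct (F N) as [n [Ln Hn]]. simpl in Hn. specialize (H n Ln). lra.
  - destruct (Hl d N) as [n [Ln Hn]]. specialize (H n Ln). lra.
Qed.

Lemma LimSup_seq_ge (u : nat -> R) d :
  (forall N, exists n, N <= n /\ (d <= u n)%R) -> Rbar_le (Finite d) (LimSup_seq u).
Proof.
  intros H. unfold LimSup_seq. destruct (ex_LimSup_seq u) as [[l| |] Hl]; simpl in *; auto.
  - destruct (Rle_lt_dec d l) as [|L]; [easy|].
    destruct (Hl (mkposreal (d - l) ltac:(lra))) as [_ [N F]].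
    destruct (H N) as [n [Ln Hn]]. specialize (F n Ln). simpl in F. lra.
  - destruct (Hl d) as [N F]. destruct (H N) as [n [Ln Hn]]. specialize (F n Ln). lra.
Qed.

Lemma LimInf_seq_le (u : nat -> R) d :
  (forall N, exists n, N <= n /\ (u n <= d)%R) -> Rbar_le (LimInf_seq u) (Finite d).
Proof.
  intros H. unfold LimInf_seq. destruct (ex_LimInf_seq u) as [[l| |] Hl]; simpl in *; auto.
  - destruct (Rle_lt_dec l d) as [|L]; [easy|].
    destruct (Hl (mkposreal (l - d) ltac:(lra))) as [_ [N F]].
    destruct (H N) as [n [Ln Hn]]. specialize (F n Ln). simpl in F. lra.
  - destruct (Hl d) as [N F]. destruct (H N) as [n [Ln Hn]]. specialize (F n Ln). lra.
Qed.

(** * Indices of machines *)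

Definition has_index (c : nat) (M : pfun) : Prop :=
  forall x y, M x = Some y <-> exists n, T c (code x) n = S (code y).

Lemma computable_has_index M : computable M -> exists c, has_index c M.
Proof.
  intros [e He]. exists (enc e). intros x y. rewrite He. apply T_spec.
Qed.

Lemma has_index_dom c M k : has_index c M -> (dom M (decode k) <-> exists n, T c k n <> 0).
Proof.
  intros H. split.
  - intros [y Hy]. apply H in Hy as [n Hn]. exists n. rewrite code_decode in Hn. congruence.
  - intros [n Hn]. destruct (T c k n) as [|v] eqn:E; [easy|].
    exists (decode v). apply H. exists n. now rewrite !code_decode.
Qed.

(** All machines and algorithms constructed below have this form: a search for the least [t] passing
    a decidable test, then an output read off from [t] and the input. *)
Lemma mu_pfun (G : nat -> nat -> bool) (r : nat -> nat -> nat) :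
  prcb 2 (fun xs => G (nth 0 xs 0) (nth 1 xs 0)) ->
  prc 2 (fun xs => r (nth 0 xs 0) (nth 1 xs 0)) ->
  exists M, computable M /\ forall x y, M x = Some y <->
    exists t, G t (code x) = true /\ (forall u, u < t -> G u (code x) = false) /\
      code y = r t (code x).
Proof.
  intros HG Hr. destruct (ev_mu G r HG Hr) as [e He].
  exists (fun x => match excluded_middle_informative (exists y, ev e [code x] (code y)) with
    | left h => Some (proj1_sig (constructive_indefinite_description _ h))
    | right _ => None end).
  assert (forall x y, match excluded_middle_informative (exists y, ev e [code x] (code y)) with
    | left h => Some (proj1_sig (constructive_indefinite_description _ h))
    | right _ => None end = Some y <-> ev e [code x] (code y)) as H.
  { intros x y. destruct (excluded_middle_informative _) as [h|h]; [|split; [easy | firstorder]].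
    destruct (constructive_indefinite_description _ h) as [z Hz]. simpl. split.
    - now intros [= <-].
    - intros Hy. f_equal. apply code_inj, (ev_det _ _ _ _ Hz Hy). }
  split; [exists e; exact H|]. intros x y. now rewrite H, He.
Qed.

Lemma least (P : nat -> bool) n : P n = true ->
  exists t, P t = true /\ t <= n /\ forall u, u < t -> P u = false.
Proof.
  induction n as [n IH] using lt_wf_ind. intros H.
  destruct (excluded_middle_informative (exists u, u < n /\ P u = true)) as [[u [L Hu]]|N].
  - destruct (IH u L Hu) as [t [Pt [Lt Ht]]]. exists t. repeat split; auto. lia.
  - exists n. repeat split; auto. intros u L. destruct (P u) eqn:E; [|easy].
    exfalso. apply N. now exists u.
Qed.

(** The additive constant in lengths becomes a factor [2 ^ c]; one more factor 2 covers the spread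
    of the codes of strings of one length. *)
Lemma C_le_plus_code U V c x p : C_le_plus U V c -> V p = Some x ->
  exists q, U q = Some x /\ S (code q) <= 2 ^ S c * S (code p).
Proof.
  intros H Hp. destruct (H x p Hp) as [q [Hq L]]. exists q. split; [easy|].
  pose proof (code_bounds p). pose proof (code_bounds q).
  assert (2 ^ S (length q) <= 2 ^ (S c + length p)) by (apply Nat.pow_le_mono_r; lia).
  rewrite Nat.pow_add_r in *. nia.
Qed.

Lemma length_of_code p q c : S (code q) <= 2 ^ c * S (code p) -> length q <= length p + c.
Proof.
  intros H. pose proof (code_bounds p). pose proof (code_bounds q).
  assert (2 ^ length q < 2 ^ (c + S (length p))) as L.
  { rewrite Nat.pow_add_r. pose proof (Nat.pow_nonzero 2 c). nia. }
  apply Nat.pow_lt_mono_r_iff in L; lia.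
Qed.

Lemma eventually_all (Q : nat -> nat -> Prop) n :
  (forall y, y < n -> exists s, forall s', s <= s' -> Q y s') ->
  exists s, forall y, y < n -> forall s', s <= s' -> Q y s'.
Proof.
  induction n as [|n IH]; intros H; [exists 0; lia|].
  destruct IH as [s1 H1]; [intros y L; apply H; lia|].
  destruct (H n) as [s2 H2]; [lia|].
  exists (s1 + s2). intros y L s' Ls.
  destruct (Nat.eq_dec y n) as [->|]; [apply H2; lia | apply H1; lia].
Qed.

Lemma nth_exists P i b : i < cnt P b -> exists z, cnt P z = i /\ P z = true.
Proof.
  induction b as [|b IH]; cbn [cnt]; [lia|]. intros H.
  destruct (Nat.lt_ge_cases i (cnt P b)) as [L|L]; [auto|].
  exists b. destruct (P b); simpl in H; [|lia]. split; [lia|easy].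
Qed.

Lemma T_fun c x n m y z : T c x n = S y -> T c x m = S z -> y = z.
Proof.
  intros Hy Hz. apply T_stable with (m := n + m) in Hy; [|lia].
  apply T_stable with (m := n + m) in Hz; [|lia]. congruence.
Qed.

Lemma T_nonzero_stable c x n m : T c x n <> 0 -> n <= m -> T c x m <> 0.
Proof.
  intros H L. destruct (T c x n) as [|v] eqn:E; [easy|].
  now rewrite (T_stable _ _ _ _ _ E L).
Qed.

Lemma has_index_decode c M k v :
  has_index c M -> (M (decode k) = Some (decode v) <-> exists n, T c k n = S v).
Proof. intros H. now rewrite (H (decode k) (decode v)), !code_decode. Qed.

Lemma err_false U A u a k : has_index u U -> has_index a A ->
  (err U A k = false <->
   ((exists n, T u k n <> 0) /\ (exists n, T a k n = 3)) \/
   (~ (exists n, T u k n <> 0) /\ (exists n, T a k n = 2))).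
Proof.
  intros Hu Ha. rewrite <- (has_index_dom u U k Hu), <- !(has_index_decode a A k _ Ha).
  change (decode 2) with (decode (code [true])). change (decode 1) with (decode (code [false])).
  rewrite !decode_code. rewrite <- not_true_iff_false. unfold err, errs. rewrite decP_true.
  destruct (classic (dom U (decode k))), (classic (A (decode k) = Some [true])),
    (classic (A (decode k) = Some [false])); tauto.
Qed.

(** * Lower bound on errors for optimal machines *)

Lemma log2_block m w : 2 ^ m <= w < 2 ^ S m -> Nat.log2 w = m.
Proof. intros H. apply Nat.log2_unique; lia. Qed.

(* [T e y s = 2] and [T e y s = 3] mean the answers [[false]] (code 1) and [[true]] (code 2). *)
Definition unresolved u e s y : bool :=
  negb ((T e y s =? 2) || (T e y s =? 3) && negb (T u y s =? 0)).

Definition mostly_resolved u (E : nat -> nat) m j s : bool :=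
  4 * cnt (unresolved u (E (m + 2 * j)) s) (nstr (m + 2 * j)) <=? 2 ^ m.

Definition unlisted u n s z : bool := negb (bex (nstr n) (fun y => T u y s =? S z)).

(* The description [pk j w] encodes [m = log2 w] and [n = m + 2 * j]; its output, held in [ps t],
   is the [w]-th number not listed at stage [pf t], the first adequate one. *)
Definition unlisted_search u E t p : bool :=
  let m := Nat.log2 (ps p) in let j := pf p in
  mostly_resolved u E m j (pf t) && negb (bex (pf t) (mostly_resolved u E m j)) &&
  (unlisted u (m + 2 * j) (pf t) (ps t) && (cnt (unlisted u (m + 2 * j) (pf t)) (ps t) =? ps p)).

(** Finitely many programs list finitely many outputs, so all numbers from some [B] on are
    unlisted. *)
Lemma unlisted_unbounded u n s i : exists z, cnt (unlisted u n s) z = i /\ unlisted u n s z = true.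
Proof.
  assert (exists B, forall y, y < nstr n -> forall z, B <= z -> T u y s <> S z) as [B HB].
  { apply (eventually_all (fun y z => T u y s <> S z)).
    intros y _. exists (T u y s). lia. }
  apply (nth_exists _ i (B + S i)).
  apply Nat.lt_le_trans with (S i); [lia|].
  assert (forall z, B <= z < B + S i -> unlisted u n s z = true) as H.
  { intros z [L _]. unfold unlisted. destruct (bex _ _) eqn:X; [|easy].
    apply bex_spec in X as [y [Ly Hy]]. apply Nat.eqb_eq in Hy. now apply HB in Hy. }
  now apply cnt_from.
Qed.

(** Suppose there are at most [2 ^ m / 4] errors. At the first mostly resolved stage [s], the
    [2 ^ m] inputs [pk j w] with [Nat.log2 w = m] yield distinct unlisted outputs under [V]. By
    optimality these have distinct [U]-descriptions of length at most [n], all halting only after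
    [s]. Such a program is either unresolved at [s] or wrongly declared non-halting, and there are
    at most [2 ^ m / 2] of both kinds together. *)
Lemma errors_lower_bound U (E : nat -> nat) : optimal U ->
  (forall k a, prc k a -> prc k (fun xs => E (a xs))) ->
  exists j, forall m A, has_index (E (m + 2 * j)) A ->
    2 ^ m < 4 * cnt (err U A) (nstr (m + 2 * j)).
Proof.
  intros [MU OU] HE. destruct (computable_has_index U MU) as [u Hu].
  destruct (mu_pfun (unlisted_search u E) (fun t _ => ps t)) as [V [MV HV]].
  { unfold unlisted_search, mostly_resolved, unlisted, unresolved, nstr. cbv zeta.
    repeat (prc_auto; lazymatch goal with |- prc ?k (fun xs => E (@?a xs)) => apply (HE k a) end). }
  { prc_auto. }
  (* [V] reads [j] from its input, so [j] may depend on [c]. With [j = c + 2] the factor [2 ^ S c]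
     and the bound [2 ^ j * (4 * 2 ^ m)] on [S (pk j w)] multiply to exactly [2 ^ S n]. *)
  destruct (OU V MV) as [c HC]. exists (c + 2). set (j := c + 2). intros m A HA.
  set (n := m + 2 * j) in *. apply Nat.nle_gt. intros Few.
  (* Every string without error is resolved from some stage on, so in the end only errors are
     unresolved. *)
  assert (exists s, mostly_resolved u E m j s = true) as [s' Hs'].
  { destruct (eventually_all (fun y s => err U A y = false -> unresolved u (E n) s y = false) (nstr n))
      as [s Hs].
    - intros y _. destruct (err U A y) eqn:Ee; [now exists 0|].
      apply (err_false U A u (E n)) in Ee; [|easy..].
      destruct Ee as [[[n1 H1] [n2 H2]]|[_ [n2 H2]]].
      + exists (n1 + n2). intros s Ls _. unfold unresolved.
        rewrite (T_stable _ _ _ _ _ H2) by lia.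
        apply T_nonzero_stable with (m := s) in H1; [|lia].
        now apply Nat.eqb_neq in H1 as ->.
      + exists n2. intros s Ls _. unfold unresolved. now rewrite (T_stable _ _ _ _ _ H2).
    - exists s. unfold mostly_resolved. apply Nat.leb_le. fold n.
      enough (cnt (unresolved u (E n) s) (nstr n) <= cnt (err U A) (nstr n)) by lia.
      apply cnt_sub. intros y Ly By. destruct (err U A y) eqn:Ee; [easy|].
      now rewrite (Hs y Ly s) in By. }
  destruct (least _ _ Hs') as [s [Gs [_ Ls]]]. clear s' Hs'.
  (* The programs that halt, but not by stage [s]. *)
  set (X := fun y => decP (exists k, T u y k <> 0) && (T u y s =? 0)).
  assert (2 ^ m <= cnt X (nstr n)) as Many.
  { apply Nat.le_trans with (cnt (fun w => 2 ^ m <=? w) (2 ^ m + 2 ^ m)).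
    { apply cnt_from. intros w L. apply Nat.leb_le. lia. }
    apply cnt_inj_rel with (R := fun w y => exists z, cnt (unlisted u n s) z = w /\
      U (decode y) = Some (decode z)).
    - intros w Lw Pw. apply Nat.leb_le in Pw.
      assert (Nat.log2 w = m) as Lm by (apply log2_block; simpl; lia).
      assert (exists z, V (decode (pk j w)) = Some (decode z) /\ unlisted u n s z = true /\
        cnt (unlisted u n s) z = w) as [z [Vz [Nz Cz]]].
      { destruct (unlisted_unbounded u n s w) as [z0 [C0 N0]].
        destruct (least (fun t => unlisted_search u E t (pk j w)) (pk s z0)) as [t [Gt [_ Lt]]].
        { unfold unlisted_search. cbv zeta. rewrite !pf_pk, !ps_pk, Lm. fold n.
          rewrite Gs, N0, C0, Nat.eqb_refl. simpl.
          destruct (bex _ _) eqn:B; [|easy].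
          apply bex_spec in B as [v [Lv Gv]]. now rewrite (Ls v Lv) in Gv. }
        exists (ps t). split.
        - apply HV. exists t. now rewrite !code_decode.
        - unfold unlisted_search in Gt. cbv zeta in Gt. rewrite !pf_pk, !ps_pk, Lm in Gt. fold n in Gt.
          apply andb_prop in Gt as [Gt Gz]. apply andb_prop in Gt as [G1 G2].
          apply andb_prop in Gz as [Gz1 Gz2]. apply Nat.eqb_eq in Gz2.
          assert (pf t = s) as <-; [|easy].
          destruct (Nat.lt_trichotomy (pf t) s) as [L|[L|L]]; [|easy|].
          + now rewrite (Ls _ L) in G1.
          + apply negb_true_iff in G2. rewrite <- not_true_iff_false in G2.
            exfalso. apply G2, bex_spec. now exists s. }
      destruct (C_le_plus_code U V c _ _ HC Vz) as [q [Uq Lq]].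
      rewrite code_decode, S_pk in Lq.
      assert (code q < nstr n) as Ln.
      { assert (2 ^ S c * (2 ^ j * (2 * w + 1)) < 2 ^ (S n)) as L; [|unfold nstr; lia].
        replace (2 ^ S n) with (2 ^ S c * (2 ^ j * (4 * 2 ^ m))).
        - apply Nat.mul_lt_mono_pos_l; [apply Nat.neq_0_lt_0, Nat.pow_nonzero; lia|].
          apply Nat.mul_lt_mono_pos_l; [apply Nat.neq_0_lt_0, Nat.pow_nonzero; lia|]. lia.
        - change 4 with (2 ^ 2). rewrite <- !Nat.pow_add_r. f_equal. unfold n, j. lia. }
      exists (code q). split; [exact Ln|]. split.
      + apply Hu in Uq. rewrite code_decode in Uq. destruct Uq as [k Hk].
        unfold X. apply andb_true_intro. split; [apply decP_true; exists k; congruence|].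
        apply Nat.eqb_eq. destruct (T u (code q) s) as [|v] eqn:Ev; [easy|].
        rewrite (T_fun _ _ _ _ _ _ Ev Hk) in Ev. exfalso.
        unfold unlisted in Nz. apply negb_true_iff in Nz. rewrite <- not_true_iff_false in Nz.
        apply Nz, bex_spec. exists (code q). split; [exact Ln | now apply Nat.eqb_eq].
      + exists z. now rewrite decode_code.
    - intros w w' y [z [Cz Uz]] [z' [Cz' Uz']]. rewrite Uz in Uz'. injection Uz' as Ez.
      apply (f_equal code) in Ez. rewrite !code_decode in Ez. congruence. }
  assert (cnt X (nstr n) <= cnt (unresolved u (E n) s) (nstr n) + cnt (err U A) (nstr n)) as Few'.
  { etransitivity; [|apply cnt_or]. apply cnt_sub. intros y Ly Xy.
    apply andb_prop in Xy as [Dy Sy]. apply Nat.eqb_eq in Sy. apply (proj1 (decP_true _)) in Dy.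
    destruct (unresolved u (E n) s y) eqn:By; [easy|]. destruct (err U A y) eqn:Ee; [easy|]. exfalso.
    unfold unresolved in By. apply negb_false_iff in By. rewrite Sy, andb_false_r, orb_false_r in By.
    apply Nat.eqb_eq in By.
    apply (err_false U A u (E n)) in Ee; [|easy..].
    destruct Ee as [[_ [n2 H2]]|[ND _]]; [|contradiction].
    pose proof (T_fun _ _ _ _ _ _ By H2). lia. }
  unfold mostly_resolved in Gs. apply Nat.leb_le in Gs. fold n in Gs.
  pose proof (Nat.pow_nonzero 2 m). lia.
Qed.

(** A constant [E] bounds the errors of one algorithm at all large lengths. With [E := pf], each
    index [a] is used at the infinitely many lengths [pk a b], and [j], hence the bound, is the same
    for all algorithms. *)
Lemma E_lower_pos_E_upper_ge U : optimal U ->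
  (forall A, algorithm A -> Rbar_lt (Finite 0) (E_lower U A)) /\
  (exists e : R, (0 < e)%R /\ forall A, algorithm A -> Rbar_le (Finite e) (E_upper U A)).
Proof.
  assert (forall m j q, 2 ^ m < 4 * q -> nstr (m + 2 * j) <= 2 ^ (2 * j + 3) * q) as Arith.
  { intros m j q H. unfold nstr. replace (S (m + 2 * j)) with (2 * j + 1 + m) by lia.
    replace (2 * j + 3) with (2 * j + 1 + 2) by lia.
    rewrite !(Nat.pow_add_r 2 (2 * j + 1)). change (2 ^ 2) with 4. nia. }
  intros OU. split.
  - intros A HA. destruct (computable_has_index A HA) as [a Ha].
    destruct (errors_lower_bound U (fun _ => a) OU) as [j Hj]; [intros; apply prc_const|].
    apply Rbar_lt_le_trans with (Finite (/ INR (2 ^ (2 * j + 3)))).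
    + simpl. apply Rinv_0_lt_compat, lt_0_INR, Nat.neq_0_lt_0, Nat.pow_nonzero. lia.
    + apply LimInf_seq_ge with (2 * j). intros n Ln. apply eps_n_ge.
      specialize (Hj (n - 2 * j) A Ha). apply (Arith _ j) in Hj.
      now replace (n - 2 * j + 2 * j) with n in Hj by lia.
  - destruct (errors_lower_bound U pf OU) as [j Hj]; [apply prc_pf|].
    exists (/ INR (2 ^ (2 * j + 3)))%R. split.
    + apply Rinv_0_lt_compat, lt_0_INR, Nat.neq_0_lt_0, Nat.pow_nonzero. lia.
    + intros A HA. destruct (computable_has_index A HA) as [a Ha].
      apply LimSup_seq_ge. intros N. exists (pk a (N + 2 * j)).
      pose proof (pk_ge_r a (N + 2 * j)) as L. split; [lia|]. apply eps_n_ge.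
      specialize (Hj (pk a (N + 2 * j) - 2 * j) A).
      replace (pk a (N + 2 * j) - 2 * j + 2 * j) with (pk a (N + 2 * j)) in Hj by lia.
      rewrite pf_pk in Hj. apply Hj in Ha.
      replace (pk a (N + 2 * j)) with (pk a (N + 2 * j) - 2 * j + 2 * j) by lia.
      apply Arith. now replace (pk a (N + 2 * j) - 2 * j + 2 * j) with (pk a (N + 2 * j)) by lia.
Qed.

(** * Densities, and algorithms with few errors at infinitely many lengths *)

Lemma cnt_split P Q n :
  cnt P n = cnt (fun x => P x && Q x) n + cnt (fun x => P x && negb (Q x)) n.
Proof. induction n; simpl; [easy|]. destruct (P n), (Q n); simpl; lia. Qed.

Lemma cnt_union b B k (P : nat -> bool) (Q : nat -> nat -> bool) n :
  (forall x, x < n -> P x = true -> exists i, i < k /\ Q i x = true) ->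
  (forall i, i < k -> b * cnt (Q i) n <= B) -> b * cnt P n <= k * B.
Proof.
  intros HP HQ. revert P HP. induction k as [|k IH]; intros P HP.
  - replace (cnt P n) with 0; [lia|]. symmetry.
    destruct (Nat.eq_dec (cnt P n) 0) as [|N]; [easy|].
    apply cnt_pos in N as [x [L Hx]]. destruct (HP x L Hx) as [i [Li _]]. lia.
  - rewrite (cnt_split P (Q k)).
    assert (b * cnt (fun x => P x && negb (Q k x)) n <= k * B).
    { apply IH; [intros; apply HQ; lia|]. intros x L Hx.
      apply andb_prop in Hx as [Px Nx]. destruct (HP x L Px) as [i [Li Qi]].
      exists i. split; [|easy]. assert (i <> k); [|lia]. intros ->. now rewrite Qi in Nx. }
    assert (cnt (fun x => P x && Q k x) n <= cnt (Q k) n).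
    { apply cnt_sub. intros x _ Hx. now apply andb_prop in Hx. }
    specialize (HQ k ltac:(lia)). nia.
Qed.

(** When the last [x] qualifies, everything counted so far lies among the elements of [P] up to [x],
    and these number less than [B / b]. *)
Lemma cnt_initial b B P n :
  b * cnt (fun x => P x && (b * cnt P (S x) <? B)) n <= B.
Proof.
  assert (forall m, cnt (fun x => P x && (b * cnt P (S x) <? B)) m <= cnt P m) as H.
  { intros m. apply cnt_sub. intros x _ Hx. now apply andb_prop in Hx. }
  induction n as [|n IH]; [simpl; lia|].
  destruct (P n && (b * cnt P (S n) <? B)) eqn:E.
  - apply andb_prop in E as [_ E]. apply Nat.ltb_lt in E. specialize (H (S n)). nia.
  - cbn [cnt] in *. rewrite E. simpl. exact IH.
Qed.

(** [a / b] approximates the upper limit of [H / N] from below: [a] is found, classically, as the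
    last value whose bound recurs forever, and [S b] is too large because [H q <= N q]. The
    constants [a] and [q0] can then be built into an algorithm. *)
Lemma frequent_density b (H N : nat -> nat) :
  (forall q, 0 < N q) -> (forall q, H q <= N q) ->
  exists a q0, (forall q1, exists q, q1 <= q /\ a * N q <= b * H q) /\
    (forall q, q0 <= q -> b * H q < S a * N q).
Proof.
  intros HN HH.
  assert (forall k, (forall a, a <= k -> forall q1, exists q, q1 <= q /\ a * N q <= b * H q) \/
    exists a q0, (forall q1, exists q, q1 <= q /\ a * N q <= b * H q) /\
      (forall q, q0 <= q -> b * H q < S a * N q)) as Step.
  { induction k as [|k [IH|IH]]; [|destruct (classic (forall q1, exists q, q1 <= q /\
      S k * N q <= b * H q)) as [Y|NY]|now right].
    - left. intros a L q1. exists q1. split; [lia|]. replace a with 0 by lia. lia.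
    - left. intros a L. destruct (Nat.eq_dec a (S k)) as [->|]; [exact Y | apply IH; lia].
    - right. exists k. apply not_all_ex_not in NY as [q0 Hq]. exists q0.
      split; [now apply IH|]. intros q L. apply Nat.nle_gt. intros C. apply Hq. now exists q. }
  destruct (Step (S b)) as [F|F]; [|exact F]. exfalso.
  destruct (F (S b) (Nat.le_refl _) 0) as [q [_ C]]. specialize (HN q). specialize (HH q). nia.
Qed.

Definition halted u s y : bool := negb (T u y s =? 0).

Definition in_dom (U : pfun) y : bool := decP (dom U (decode y)).

Lemma halted_in_dom U u s y : has_index u U -> halted u s y = true -> in_dom U y = true.
Proof.
  intros Hu H. apply decP_true. apply (has_index_dom u U y Hu). exists s.
  now apply negb_true_iff, Nat.eqb_neq in H.
Qed.

Lemma eventually_halted U u n : has_index u U ->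
  exists s, forall y, y < n -> halted u s y = in_dom U y.
Proof.
  intros Hu. destruct (eventually_all (fun y s => halted u s y = in_dom U y) n) as [s Hs].
  - intros y _. destruct (in_dom U y) eqn:E.
    + apply (proj1 (decP_true _)), (has_index_dom u U y Hu) in E as [s H]. exists s.
      intros s' L. apply negb_true_iff, Nat.eqb_neq. now apply T_nonzero_stable with s.
    + exists 0. intros s _. rewrite <- not_true_iff_false in *. intros H.
      now apply (halted_in_dom U) in H.
  - exists s. intros y L. now apply Hs.
Qed.

Lemma halted_cnt U u n s : has_index u U ->
  cnt (in_dom U) n = cnt (halted u s) n + cnt (fun y => in_dom U y && negb (halted u s y)) n.
Proof.
  intros Hu. rewrite (cnt_split _ (halted u s)). f_equal. apply cnt_ext_lt. intros y _.
  destruct (halted u s y) eqn:E; [|apply andb_false_r].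
  now rewrite (halted_in_dom U u s y Hu E).
Qed.

(** With lengths spaced by [k], all strings up to the previous length are a negligible fraction. *)
Lemma nstr_block k q : 2 ^ k * nstr (k * q) <= nstr (k * S q).
Proof.
  unfold nstr. replace (S (k * S q)) with (k + S (k * q)) by lia. rewrite Nat.pow_add_r.
  pose proof (Nat.pow_nonzero 2 k). nia.
Qed.

Lemma nstr_mono m n : m <= n -> nstr m <= nstr n.
Proof.
  intros L. unfold nstr. assert (2 ^ S m <= 2 ^ S n); [|lia]. apply Nat.pow_le_mono_r; lia.
Qed.

Lemma cnt_ltb a n : cnt (fun x => x <? a) n <= a.
Proof. apply (cnt_interval _ 0). intros x H. apply Nat.ltb_lt in H. lia. Qed.

Lemma E_lower_le (U A : pfun) d :
  0 < d -> (forall N, exists n, N <= n /\ d * cnt (err U A) (nstr n) <= nstr n) ->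
  Rbar_le (E_lower U A) (Finite (/ INR d)).
Proof.
  intros Pd H. apply LimInf_seq_le. intros M. destruct (H M) as [n [L C]].
  exists n. split; [easy|]. now apply eps_n_le.
Qed.

(** [t] encodes a position [pf t] in the progression of lengths and a time [ps t]; [b] is both the
    spacing of the lengths and the denominator of the density. *)
Definition density_reached u b a x t : bool :=
  (x <? nstr (b * pf t)) &&
  (a * nstr (b * pf t) <=? b * cnt (halted u (ps t)) (nstr (b * pf t))).

(** Having seen density [a / b] at some length, the algorithm declares all remaining strings
    non-halting. As the density stays below [S a / b], less than a fraction [1 / b] of them is
    misjudged; with [b = 2 * d] this and the [x0] short strings each cost half of the allowance. *)
Lemma errors_infinitely_often_small U d : machine U -> 0 < d ->
  exists A, algorithm A /\
    forall N, exists n, N <= n /\ d * cnt (err U A) (nstr n) <= nstr n.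
Proof.
  intros MU Pd. destruct (computable_has_index U MU) as [u Hu]. set (b := 2 * d).
  destruct (frequent_density b (fun q => cnt (in_dom U) (nstr (b * q))) (fun q => nstr (b * q)))
    as [a [q0 [Inf Sup]]]; [intros; apply nstr_pos | intros; apply cnt_le|].
  destruct (mu_pfun (fun t x => density_reached u b a x t)
    (fun t x => if halted u (ps t) x then 2 else 1)) as [A [MA HA]].
  { unfold density_reached, halted, nstr. prc_auto. }
  { unfold halted. prc_auto. }
  exists A. split; [exact MA|]. intros N.
  destruct (Inf (S (q0 + N))) as [q [Lq Cq]].
  destruct (eventually_halted U u (nstr (b * q)) Hu) as [s0 Hs0].
  set (x0 := nstr (b * (q - 1))).
  assert (2 ^ b * x0 <= nstr (b * q)) as Bx0.
  { unfold x0. replace (b * q) with (b * S (q - 1)) by (f_equal; lia). apply nstr_block. }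
  pose proof (Nat.pow_gt_lin_r 2 b ltac:(lia)) as Lb.
  assert (0 < x0) by apply nstr_pos.
  destruct (least (density_reached u b a x0) (pk q s0)) as [t [Gt [_ Lt]]].
  { unfold density_reached. rewrite pf_pk, ps_pk. apply andb_true_intro.
    rewrite Nat.ltb_lt, Nat.leb_le. split; [nia|].
    now rewrite (cnt_ext_lt _ _ _ Hs0). }
  set (n := pf t) in *. set (s := ps t) in *.
  unfold density_reached in Gt. fold n s in Gt.
  apply andb_prop in Gt as [G1 G2]. apply Nat.ltb_lt in G1. apply Nat.leb_le in G2.
  assert (q <= n) as Ln.
  { apply Nat.nlt_ge. intros L. apply (Nat.lt_irrefl x0).
    apply Nat.lt_le_trans with (1 := G1). apply nstr_mono. nia. }
  exists (b * n). split; [nia|].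
  assert (cnt (err U A) (nstr (b * n)) <=
    x0 + cnt (fun y => in_dom U y && negb (halted u s y)) (nstr (b * n))) as B.
  { etransitivity; [|apply Nat.add_le_mono_r, (cnt_ltb x0 (nstr (b * n)))].
    etransitivity; [|apply cnt_or]. apply cnt_sub. intros x Lx Ex.
    destruct (Nat.ltb_spec x x0) as [|Lx0]; [easy|]. simpl.
    (* Only the clause on the size of [x] depends on [x], and it is harder for larger [x]; so every
       [x] from [x0] up to [nstr (b * n)] finds the same [t] as [x0]. *)
    assert (A (decode x) = Some (decode (if halted u s x then 2 else 1))) as Ax.
    { apply HA. rewrite !code_decode. exists t. split; [|split; [|easy]].
      - unfold density_reached. fold n s. apply andb_true_intro. now rewrite Nat.ltb_lt, Nat.leb_le.
      - intros v Lv. specialize (Lt v Lv). unfold density_reached in *.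
        destruct (a * _ <=? _); [|apply andb_false_r]. rewrite andb_true_r in *.
        apply Nat.ltb_ge in Lt. apply Nat.ltb_ge. lia. }
    apply (proj1 (decP_true _)) in Ex. unfold errs in Ex. rewrite Ax in Ex.
    change 2 with (code [true]) in Ex. change 1 with (code [false]) in Ex.
    destruct (halted u s x) eqn:Hx; rewrite decode_code in Ex.
    - apply (halted_in_dom U) in Hx; [|easy]. apply (proj1 (decP_true _)) in Hx. tauto.
    - rewrite andb_true_r. apply decP_true. tauto. }
  specialize (Sup n ltac:(lia)). cbv beta in Sup. rewrite (halted_cnt U u _ s Hu) in Sup.
  assert (nstr (b * q) <= nstr (b * n)) by (apply nstr_mono; nia).
  assert (b * x0 <= nstr (b * n)) by nia.
  unfold b in *. nia.
Qed.

(** * Left-total machines *)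

Definition same_len x y : bool := Nat.log2 (S x) =? Nat.log2 (S y).

(* The last clause: if [x] halted, so would all earlier strings of the same length, and the density
   of the domain would exceed [S a / b]. *)
Definition left_total_search u k b a q0 t x : bool :=
  halted u (ps t) x ||
  ((q0 <=? pf t) && (x <? nstr (k * pf t)) &&
   (a * nstr (k * pf t) <=? b * cnt (halted u (ps t)) (nstr (k * pf t))) &&
   (nstr (k * pf t) <=? b * cnt (fun y => same_len x y && negb (halted u (ps t) y)) (S x))).

(** All errors are undefined answers, hence on non-halting strings. For each length, such a string
    beyond the [x0] short ones has rank below [nstr (k * q) / b] among the non-halting strings of
    that length. *)
Lemma errors_left_total U d : machine U -> left_total U -> 0 < d ->
  exists A, algorithm A /\ never_wrong U A /\
    forall N, exists n, N <= n /\ d * cnt (err U A) (nstr n) <= nstr n.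
Proof.
  intros MU LU Pd. destruct (computable_has_index U MU) as [u Hu].
  (* The short strings cost a fraction [1 / k] and the [k] lengths of the last block [1 / b] each,
     together [1 / d]. *)
  set (k := 2 * d). set (b := 2 * d * k).
  destruct (frequent_density b (fun q => cnt (in_dom U) (nstr (k * q))) (fun q => nstr (k * q)))
    as [a [q0 [Inf Sup]]]; [intros; apply nstr_pos | intros; apply cnt_le|].
  destruct (mu_pfun (left_total_search u k b a q0)
    (fun t x => if halted u (ps t) x then 2 else 1)) as [A [MA HA]].
  { unfold left_total_search, halted, nstr, same_len. prc_auto. }
  { unfold halted. prc_auto. }
  assert (never_wrong U A) as NW.
  { clearbody b. intros x y Hy. apply HA in Hy as [t [Gt [_ Ey]]]. unfold left_total_search in Gt.
    destruct (halted u (ps t) (code x)) eqn:Hx.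
    - left. change 2 with (code [true]) in Ey. apply code_inj in Ey. split; [easy|].
      apply (halted_in_dom U) in Hx; [|easy]. apply (proj1 (decP_true _)) in Hx.
      now rewrite decode_code in Hx.
    - right. change 1 with (code [false]) in Ey. apply code_inj in Ey. split; [easy|]. intros Dx.
      cbn [orb] in Gt. apply andb_prop in Gt as [Gt G4]. apply andb_prop in Gt as [Gt G3].
      apply andb_prop in Gt as [G1 G2].
      apply Nat.leb_le in G1, G3, G4. apply Nat.ltb_lt in G2.
      specialize (Sup _ G1). cbv beta in Sup. rewrite (halted_cnt U u _ (ps t) Hu) in Sup.
      enough (b * cnt (fun y => same_len (code x) y && negb (halted u (ps t) y)) (S (code x)) <=
        b * cnt (fun y => in_dom U y && negb (halted u (ps t) y)) (nstr (k * pf t))) by lia.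
      apply Nat.mul_le_mono_l.
      transitivity (cnt (fun y => in_dom U y && negb (halted u (ps t) y)) (S (code x)));
        [|now apply cnt_mono].
      apply cnt_sub. intros z Lz Hz. apply andb_prop in Hz as [Ez ->]. rewrite andb_true_r.
      apply decP_true. apply Nat.eqb_eq in Ez.
      assert (length (decode z) = length x) as El.
      { rewrite <- !log2_code, code_decode. now symmetry. }
      apply LU with x; [easy| |easy]. apply code_lex_le; [easy|]. rewrite code_decode. lia. }
  exists A. split; [exact MA|]. split; [exact NW|]. intros N.
  destruct (Inf (S (q0 + N))) as [q [Lq Cq]].
  exists (k * q). split; [nia|].
  destruct (eventually_halted U u (nstr (k * q)) Hu) as [s Hs].
  set (x0 := nstr (k * (q - 1))).
  assert (2 ^ k * x0 <= nstr (k * q)) as Bx0.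
  { unfold x0. replace (k * q) with (k * S (q - 1)) by (f_equal; lia). apply nstr_block. }
  pose proof (Nat.pow_gt_lin_r 2 k ltac:(lia)) as Lb.
  set (out := fun l x => (Nat.log2 (S x) =? l) && negb (in_dom U x)).
  assert (b * cnt (fun x => err U A x && negb (x <? x0)) (nstr (k * q)) <= k * nstr (k * q)) as B.
  { apply cnt_union with (Q := fun i x => out (k * (q - 1) + S i) x &&
      (b * cnt (out (k * (q - 1) + S i)) (S x) <? nstr (k * q)));
      [|intros i _; apply cnt_initial].
    intros x Lx Ex. apply andb_prop in Ex as [Ex Lx0]. apply negb_true_iff, Nat.ltb_ge in Lx0.
    assert (forall y, A (decode x) <> Some y) as NA.
    { intros y Hy. apply (proj1 (decP_true _)) in Ex. unfold errs in Ex. rewrite Hy in Ex.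
      destruct (NW _ _ Hy) as [[-> D]|[-> D]]; intuition congruence. }
    assert (forall t, left_total_search u k b a q0 t x = false) as NG.
    { intros t. destruct (left_total_search u k b a q0 t x) eqn:Gt; [|easy]. exfalso.
      destruct (least (fun t => left_total_search u k b a q0 t x) t Gt) as [t' [Gt' [_ Lt']]].
      apply (NA (decode (if halted u (ps t') x then 2 else 1))).
      apply HA. exists t'. rewrite !code_decode. auto. }
    specialize (NG (pk q s)). unfold left_total_search in NG. rewrite pf_pk, ps_pk in NG.
    apply orb_false_elim in NG as [Hx NG]. rewrite (Hs x Lx) in Hx.
    rewrite (proj2 (Nat.leb_le q0 q)), (proj2 (Nat.ltb_lt _ _) Lx) in NG by lia.
    rewrite (cnt_ext_lt _ _ _ Hs), (proj2 (Nat.leb_le _ _) Cq) in NG. cbn [andb] in NG.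
    apply Nat.leb_gt in NG.
    assert (k * (q - 1) + 1 <= Nat.log2 (S x)) as L1.
    { apply Nat.log2_le_pow2; [lia|]. unfold x0, nstr in Lx0.
      rewrite Nat.add_1_r. lia. }
    assert (Nat.log2 (S x) < k * q + 1) as L2.
    { apply Nat.log2_lt_pow2; [lia|]. unfold nstr in Lx. rewrite Nat.add_1_r. lia. }
    exists (Nat.log2 (S x) - (k * (q - 1) + 1)). split.
    { replace (k * q) with (k * S (q - 1)) in L2 by (f_equal; lia). lia. }
    replace (k * (q - 1) + S (Nat.log2 (S x) - (k * (q - 1) + 1))) with (Nat.log2 (S x)) by lia.
    apply andb_true_intro. split.
    { unfold out. now rewrite Nat.eqb_refl, Hx. }
    apply Nat.ltb_lt. eapply Nat.le_lt_trans; [|exact NG].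
    apply Nat.mul_le_mono_l, cnt_sub. intros y Ly Hy. unfold out in Hy.
    apply andb_prop in Hy as [Ey Dy]. unfold same_len. rewrite Nat.eqb_sym, Ey. simpl.
    now rewrite Hs by lia. }
  assert (cnt (err U A) (nstr (k * q)) <=
    x0 + cnt (fun x => err U A x && negb (x <? x0)) (nstr (k * q))) as C.
  { etransitivity; [|apply Nat.add_le_mono_r, (cnt_ltb x0 (nstr (k * q)))].
    etransitivity; [|apply cnt_or]. apply cnt_sub. intros x _ ->.
    now destruct (x <? x0). }
  assert (k * x0 <= nstr (k * q)) by nia.
  assert (2 * d * cnt (fun x => err U A x && negb (x <? x0)) (nstr (k * q)) <= nstr (k * q)).
  { apply Nat.mul_le_mono_pos_l with k; [lia|]. unfold b in B. nia. }
  unfold k in *. nia.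
Qed.

(** * Passage to arbitrary real accuracy *)

Lemma E_lower_arbitrarily_small U : machine U -> forall e : R, (0 < e)%R ->
  exists A, algorithm A /\ Rbar_le (E_lower U A) (Finite e).
Proof.
  intros MU e He. destruct (archimed_cor1 e He) as [d [Hd Pd]].
  destruct (errors_infinitely_often_small U d MU Pd) as [A [MA HA]]. exists A. split; [easy|].
  apply Rbar_le_trans with (Finite (/ INR d)); [now apply E_lower_le|]. simpl. lra.
Qed.

Lemma left_total_approx U : machine U -> left_total U -> approx_by_never_wrong U.
Proof.
  intros MU LU e He. destruct (archimed_cor1 e He) as [d [Hd Pd]].
  destruct (errors_left_total U d MU LU Pd) as [A [MA [NW HA]]].
  exists A. split; [easy|]. split; [easy|].
  apply Rbar_le_trans with (Finite (/ INR d)); [now apply E_lower_le|]. simpl. lra.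
Qed.

(** * Existence of effectively optimal and of left-total optimal machines *)

Lemma option_ext {A} (a b : option A) : (forall y, a = Some y <-> b = Some y) -> a = b.
Proof.
  intros H. destruct a as [x|]; [symmetry; now apply H|].
  destruct b as [y|]; [now apply H | easy].
Qed.

Lemma effectively_optimal_optimal U : effectively_optimal U -> optimal U.
Proof.
  intros [MU EU]. split; [easy|]. intros V MV. destruct (EU V MV) as [h [c [_ [Lh Vh]]]].
  exists c. intros x p Hp. exists (h p). now rewrite <- Vh.
Qed.

(** A universal machine runs program [pf p] on [ps p]; the reduction [pk c] adds at most [S c]
    bits. *)
Lemma effectively_optimal_exists : exists U, effectively_optimal U.
Proof.
  destruct (mu_pfun (fun t p => negb (T (pf p) (ps p) t =? 0)) (fun t p => pred (T (pf p) (ps p) t)))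
    as [U [MU HU]]; [prc_auto | prc_auto |].
  exists U. split; [easy|]. intros V MV. destruct (computable_has_index V MV) as [c Hc].
  exists (fun x => decode (pk c (code x))), (S c). split; [|split].
  - assert (prc 1 (fun xs => pk c (nth 0 xs 0))) as [e He] by prc_auto.
    exists e. intros x y. specialize (He [code x] eq_refl). cbn [nth] in He. split.
    + intros [= <-]. now rewrite code_decode.
    + intros H. f_equal. apply code_inj. rewrite code_decode. exact (ev_det _ _ _ _ He H).
  - intros x. apply length_of_code. rewrite code_decode, S_pk, Nat.pow_succ_r'. nia.
  - intros x. apply option_ext. intros y. rewrite (Hc x y), HU, code_decode, pf_pk, ps_pk. split.
    + intros [n Hn]. destruct (least (fun t => negb (T c (code x) t =? 0)) n) as [t [Ht [_ Lt]]];
        [now rewrite Hn|].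
      exists t. repeat split; auto. destruct (T c (code x) t) as [|v] eqn:E; [easy|].
      simpl. symmetry. exact (T_fun _ _ _ _ _ _ E Hn).
    + intros [t [Ht [_ ->]]]. exists t. now destruct (T c (code x) t).
Qed.

(* [t] encodes a program of length [n] with the exact time at which it halts, so that every halting
   program gives one event; the [i]-th string of length [n] is then made to behave like the program
   of the [i]-th event. *)
Definition halting_event u n t : bool :=
  (Nat.log2 (S (pf t)) =? n) && (halted u (ps t) (pf t) && negb (bex (ps t) (fun s => halted u s (pf t)))).

Lemma halting_event_inj u n t t' :
  halting_event u n t = true -> halting_event u n t' = true -> pf t = pf t' -> t = t'.
Proof.
  unfold halting_event. intros H H' E.
  apply andb_prop in H as [_ H], H' as [_ H'].
  apply andb_prop in H as [H1 H2], H' as [H1' H2'].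
  apply negb_true_iff in H2, H2'. rewrite <- not_true_iff_false, bex_spec in H2, H2'.
  rewrite <- E in H1', H2'. rewrite <- (pk_pf_ps t), <- (pk_pf_ps t'), <- E. f_equal.
  destruct (Nat.lt_trichotomy (ps t) (ps t')) as [L|[L|L]]; [|easy|].
  - exfalso. apply H2'. now exists (ps t).
  - exfalso. apply H2. now exists (ps t').
Qed.

(** Distinct events belong to distinct programs of length [n], so the strings of that length suffice
    to number all events. *)
Lemma halting_event_cnt u n k : cnt (halting_event u n) k <= 2 ^ n.
Proof.
  transitivity (cnt (fun y => Nat.log2 (S y) =? n) (2 ^ S n)).
  - apply cnt_inj_rel with (R := fun t y => halting_event u n t = true /\ pf t = y).
    + intros t _ Ht. exists (pf t). pose proof Ht as Ht'.
      apply andb_prop in Ht' as [E _]. split; [|auto]. apply Nat.eqb_eq in E.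
      pose proof (Nat.log2_spec (S (pf t)) ltac:(lia)). rewrite E in *. lia.
    + intros t t' y [H <-] [H' E]. now apply (halting_event_inj u n).
  - apply (cnt_interval _ (2 ^ n - 1)). intros y E. apply Nat.eqb_eq in E.
    pose proof (Nat.log2_spec (S y) ltac:(lia)). rewrite E, Nat.pow_succ_r' in *.
    pose proof (Nat.pow_nonzero 2 n). lia.
Qed.

Lemma cnt_nth_inj P z z' :
  P z = true -> P z' = true -> cnt P z = cnt P z' -> z = z'.
Proof.
  intros H H' E. destruct (Nat.lt_trichotomy z z') as [L|[L|L]]; [|easy|].
  - pose proof (cnt_lt P z' z L H). lia.
  - pose proof (cnt_lt P z z' L H'). lia.
Qed.

(** Reordering the programs of each length by the order of their halting events keeps all
    description lengths, hence optimality. An event of some rank is preceded by events of all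
    smaller ranks, so the domain is an initial segment in each length. *)
Lemma left_total_optimal_exists : exists U, optimal U /\ left_total U.
Proof.
  destruct effectively_optimal_exists as [U0 OU0].
  apply effectively_optimal_optimal in OU0. destruct OU0 as [MU0 OU0].
  destruct (computable_has_index U0 MU0) as [u Hu].
  (* [S p - 2 ^ Nat.log2 (S p)] is the lexicographic rank of the string coded by [p] among those of
     its length. *)
  set (G := fun z p => halting_event u (Nat.log2 (S p)) z &&
    (cnt (halting_event u (Nat.log2 (S p))) z =? S p - 2 ^ Nat.log2 (S p))).
  destruct (mu_pfun G (fun z p => pred (T u (pf z) (ps z)))) as [U [MU HU]].
  { unfold G, halting_event, halted. prc_auto. }
  { prc_auto. }
  exists U. split; [split; [easy|]|].
  - intros V MV. destruct (OU0 V MV) as [c HC]. exists c. intros x p Vp.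
    destruct (HC x p Vp) as [p' [Up' Lp']].
    enough (exists q, U q = Some x /\ length q = length p') as [q [Uq Lq]] by (exists q; now rewrite Lq).
    pose proof (proj1 (Hu p' x) Up') as [s' Hs'].
    destruct (least (fun s => halted u s (code p')) s') as [s [Hs [_ Ls]]];
      [unfold halted; now rewrite Hs'|].
    set (n := length p'). set (z := pk (code p') s).
    assert (halting_event u n z = true) as Hz.
    { unfold halting_event, z. rewrite pf_pk, ps_pk, log2_code, Nat.eqb_refl, Hs. simpl.
      apply negb_true_iff. rewrite <- not_true_iff_false, bex_spec. intros [v [Lv Hv]].
      now rewrite Ls in Hv. }
    pose proof (halting_event_cnt u n (S z)) as Lz. cbn [cnt] in Lz. rewrite Hz in Lz. simpl in Lz.
    set (i := cnt (halting_event u n) z) in *.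
    assert (Nat.log2 (S (2 ^ n - 1 + i)) = n) as Ln.
    { apply Nat.log2_unique; [lia|]. rewrite Nat.pow_succ_r'. lia. }
    exists (decode (2 ^ n - 1 + i)). split; [|now rewrite <- log2_code, code_decode].
    assert (G z (2 ^ n - 1 + i) = true) as Gz.
    { unfold G. rewrite Ln, Hz. apply Nat.eqb_eq. fold i. lia. }
    apply HU. exists z. rewrite code_decode. split; [exact Gz|]. split.
    + intros v Lv. destruct (G v (2 ^ n - 1 + i)) eqn:Gv; [|easy].
      unfold G in Gv, Gz. rewrite Ln in Gv, Gz.
      apply andb_prop in Gv as [V1 V2], Gz as [Z1 Z2]. apply Nat.eqb_eq in V2, Z2.
      rewrite (cnt_nth_inj (halting_event u n) v z) in Lv; [lia|easy|easy|congruence].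
    + unfold z. rewrite pf_pk, ps_pk. unfold halted in Hs.
      destruct (T u (code p') s) as [|v] eqn:E; [easy|]. simpl.
      exact (T_fun _ _ _ _ _ _ Hs' E).
  - intros x y Lxy Exy [v Hv]. apply HU in Hv as [z [Gz _]].
    assert (code x <= code y) as Cxy.
    { apply (lex_le_num_from x y 1 Lxy) in Exy. rewrite <- !S_code in Exy. lia. }
    unfold G in Gz. apply andb_prop in Gz as [Z1 Z2]. apply Nat.eqb_eq in Z2.
    rewrite log2_code in Z1, Z2. rewrite <- Lxy in Z1, Z2.
    destruct (nth_exists (halting_event u (length x)) (S (code x) - 2 ^ length x) (S z)) as [z' [C' E']].
    { cbn [cnt]. rewrite Z1. simpl Nat.b2n. lia. }
    destruct (least (fun z => G z (code x)) z') as [t [Gt [_ Lt]]].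
    { unfold G. rewrite log2_code, E', C'. apply Nat.eqb_refl. }
    exists (decode (pred (T u (pf t) (ps t)))). apply HU. exists t. now rewrite code_decode.
Qed.

(** * Effectively optimal machines and algorithms that are never wrong *)

Definition in_block m w : bool := (2 ^ m <=? w) && (w <? 2 ^ S m).

(** Program [i] is meant to be the reduction of [V] to [U]; reading its index from the input avoids
    a fixed-point theorem. [v] encodes a string of the block and a time by which algorithm [e] has
    rejected its image. *)
Definition hit i m e v : bool :=
  in_block m (pf v) && (negb (T i (pk i (pf v)) (ps v) =? 0) &&
  (T e (pred (T i (pk i (pf v)) (ps v))) (ps v) =? 2)).

Definition first_hit i m e v : bool := hit i m e v && negb (bex v (hit i m e)).

Definition collides i m w t : bool :=
  negb (T i (pk i w) t =? 0) &&
  bex (2 ^ S m) (fun w' => in_block m w' && (negb (w' =? w) && (T i (pk i w') t =? T i (pk i w) t))).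

(* Halting on colliding inputs forces the reduction to be injective on each block, since [V] outputs
   [w] on [pk i w]. *)
Definition diagonal_search t p : bool :=
  let i := pf p in let w := ps p in let m := Nat.log2 w in
  collides i m w t || bex m (fun e => bex t (fun v => first_hit i m e v && (pf v =? w))).

Lemma in_block_spec m w : in_block m w = true <-> 2 ^ m <= w < 2 ^ S m.
Proof. unfold in_block. now rewrite andb_true_iff, Nat.leb_le, Nat.ltb_lt. Qed.

(** If an algorithm with index below [m] rejected the image of some [w] of the block, its first hit
    would make [V] halt, putting a rejected image into the domain of [U]. So it rejects none, and
    every image outside the domain is an error. The images are distinct, and at most [m] of the
    [2 ^ m] lie in the domain. *)
Lemma effectively_optimal_errors U : effectively_optimal U ->
  exists d r, 0 < d /\ forall A, algorithm A -> never_wrong U A ->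
    exists N, forall n, N <= n -> nstr (n + r) <= d * cnt (err U A) (nstr (n + r)).
Proof.
  intros [MU EU]. 
  destruct (mu_pfun diagonal_search (fun _ p => ps p)) as [V [MV HV]].
  { unfold diagonal_search, collides, first_hit, hit, in_block. cbv zeta. prc_auto. }
  { prc_auto. }
  destruct (EU V MV) as [h [c [Ch [Lh Vh]]]].
  destruct (computable_has_index _ Ch) as [i Hi].
  set (H := fun w => code (h (decode (pk i w)))).
  assert (forall w, exists n, T i (pk i w) n = S (H w)) as HT.
  { intros w. destruct (proj1 (Hi (decode (pk i w)) (h (decode (pk i w)))) eq_refl) as [n Hn].
    exists n. now rewrite code_decode in Hn. }
  assert (forall w n, T i (pk i w) n <> 0 -> T i (pk i w) n = S (H w)) as HT0.
  { intros w n Hn. destruct (T i (pk i w) n) as [|v] eqn:E; [easy|].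
    destruct (HT w) as [n' Hn']. now rewrite (T_fun _ _ _ _ _ _ E Hn'). }
  assert (forall m w t, in_block m w = true -> diagonal_search t (pk i w) = true ->
    U (decode (H w)) = Some (decode w)) as Kill.
  { intros m w t Bw Gt. unfold H. rewrite decode_code, <- Vh. apply HV. rewrite !code_decode.
    destruct (least (fun t => diagonal_search t (pk i w)) t Gt) as [t' [Gt' [_ Lt']]].
    exists t'. now rewrite ps_pk. }
  assert (forall m w, in_block m w = true -> Nat.log2 w = m) as Blog.
  { intros m w B. apply in_block_spec in B. apply Nat.log2_unique; lia. }
  assert (forall m w w', in_block m w = true -> in_block m w' = true -> H w = H w' -> w = w')
    as Inj.
  { intros m w w' B B' E. destruct (Nat.eq_dec w w') as [|NE]; [easy|].
    destruct (HT w) as [n Hn], (HT w') as [n' Hn'].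
    apply T_stable with (m := n + n') in Hn; [|lia]. apply T_stable with (m := n + n') in Hn'; [|lia].
    assert (forall v v', in_block m v = true -> in_block m v' = true -> v <> v' ->
      T i (pk i v) (n + n') = S (H w) -> T i (pk i v') (n + n') = S (H w) ->
      diagonal_search (n + n') (pk i v) = true) as C.
    { intros v v' Bv Bv' N Ev Ev'. unfold diagonal_search. cbv zeta. rewrite pf_pk, ps_pk, (Blog m v Bv).
      apply orb_true_intro. left. unfold collides. rewrite Ev. simpl negb. cbn [andb].
      apply bex_spec. exists v'. split; [now apply in_block_spec in Bv'|].
      rewrite Bv', Ev'. rewrite Nat.eqb_refl, andb_true_r. simpl.
      apply negb_true_iff, Nat.eqb_neq. congruence. }
    rewrite <- E in Hn'.
    pose proof (Kill m w _ B (C w w' B B' NE Hn Hn')) as K.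
    pose proof (Kill m w' _ B' (C w' w B' B ltac:(congruence) Hn' Hn)) as K'.
    rewrite <- E, K in K'. injection K' as K'. apply (f_equal code) in K'.
    now rewrite !code_decode in K'. }
  assert (forall m e v, hit i m e v = true -> T e (H (pf v)) (ps v) = 2) as Hit.
  { intros m e v Hv. unfold hit in Hv. apply andb_prop in Hv as [_ Hv].
    apply andb_prop in Hv as [N Hv]. apply negb_true_iff, Nat.eqb_neq in N.
    rewrite (HT0 _ _ N) in Hv. now apply Nat.eqb_eq in Hv. }
  set (killed := fun m w => in_block m w && decP (dom U (decode (H w)))).
  (* By injectivity no collision occurs, so each killed [w] is charged to an index [e < m] whose
     first hit it is. *)
  assert (forall m, cnt (killed m) (2 ^ S m) <= m) as Few.
  { intros m. transitivity (cnt (fun _ => true) m); [|apply cnt_le].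
    apply cnt_inj_rel with (R := fun w e => exists v, first_hit i m e v = true /\ pf v = w).
    - intros w _ Kw. apply andb_prop in Kw as [Bw Dw]. apply (proj1 (decP_true _)) in Dw.
      unfold H in Dw. rewrite decode_code in Dw. destruct Dw as [y Hy]. rewrite <- Vh in Hy.
      apply HV in Hy as [t [Gt _]]. rewrite code_decode in Gt. unfold diagonal_search in Gt. cbv zeta in Gt.
      rewrite pf_pk, ps_pk, (Blog m w Bw) in Gt. apply orb_prop in Gt as [Gt|Gt].
      + exfalso. unfold collides in Gt. apply andb_prop in Gt as [N Gt].
        apply negb_true_iff, Nat.eqb_neq in N. apply bex_spec in Gt as [w' [_ Gt]].
        apply andb_prop in Gt as [Bw' Gt]. apply andb_prop in Gt as [NE Gt].
        apply negb_true_iff, Nat.eqb_neq in NE. apply Nat.eqb_eq in Gt.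
        apply NE, (Inj m); [easy..|].
        pose proof (HT0 _ _ N) as E. rewrite <- Gt in N. apply HT0 in N. congruence.
      + apply bex_spec in Gt as [e [Le Gt]]. apply bex_spec in Gt as [v [_ Gt]].
        apply andb_prop in Gt as [F E]. apply Nat.eqb_eq in E. exists e. repeat split; auto.
        now exists v.
    - intros w w' e [v [F <-]] [v' [F' <-]]. f_equal. unfold first_hit in F, F'.
      apply andb_prop in F as [F1 F2], F' as [F1' F2'].
      apply negb_true_iff in F2, F2'. rewrite <- not_true_iff_false, bex_spec in F2, F2'.
      destruct (Nat.lt_trichotomy v v') as [L|[L|L]]; [|easy|]; exfalso.
      + apply F2'. now exists v.
      + apply F2. now exists v'. }
  (* [pk i w] codes a string of length at most [i + m + 1] and [h] adds at most [c]; the errors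
     number at least [2 ^ m / 2]. The start [S a] below ensures [a < m]. *)
  exists (2 ^ (c + i + 4)), (c + i + 2). split; [apply Nat.neq_0_lt_0, Nat.pow_nonzero; lia|].
  intros A MA NW. destruct (computable_has_index A MA) as [a Ha]. exists (S a). intros m Lm.
  assert (forall w, in_block m w = true -> A (decode (H w)) <> Some [false]) as Safe.
  { intros w Bw Aw. rewrite <- (decode_code [false]) in Aw.
    apply (has_index_decode a A (H w) _ Ha) in Aw as [n1 H1]. change (code [false]) with 1 in H1.
    destruct (HT w) as [n2 H2].
    apply T_stable with (m := n1 + n2) in H1; [|lia]. apply T_stable with (m := n1 + n2) in H2; [|lia].
    destruct (least (hit i m a) (pk w (n1 + n2))) as [v [Hv [_ Lv]]].
    { unfold hit. rewrite pf_pk, ps_pk, Bw, H2. simpl pred. now rewrite H1. }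
    pose proof Hv as Bv. unfold hit in Bv. apply andb_prop in Bv as [Bv _].
    assert (A (decode (H (pf v))) = Some [false]) as Av.
    { rewrite <- (decode_code [false]). apply (has_index_decode a A _ _ Ha).
      exists (ps v). exact (Hit _ _ _ Hv). }
    destruct (NW _ _ Av) as [[E _]|[_ ND]]; [discriminate E|]. apply ND.
    exists (decode (pf v)). apply (Kill m _ (S v) Bv).
    unfold diagonal_search. cbv zeta. rewrite pf_pk, ps_pk, (Blog m _ Bv).
    apply orb_true_intro. right. apply bex_spec. exists a. split; [lia|].
    apply bex_spec. exists v. split; [lia|]. rewrite Nat.eqb_refl, andb_true_r.
    unfold first_hit. rewrite Hv. simpl. apply negb_true_iff.
    rewrite <- not_true_iff_false, bex_spec. intros [v' [L' H']]. now rewrite Lv in H'. }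
  assert (cnt (fun w => in_block m w && negb (decP (dom U (decode (H w))))) (2 ^ S m) <=
    cnt (err U A) (nstr (m + (c + i + 2)))) as Many.
  { apply cnt_inj_rel with (R := fun w y => in_block m w = true /\ H w = y).
    - intros w _ Hw. apply andb_prop in Hw as [Bw Dw]. exists (H w). split; [|split; [|easy]].
      + pose proof (proj1 (in_block_spec m w) Bw) as [_ Lw].
        assert (S (H w) < 2 ^ S (m + (c + i + 2))) as L; [|unfold nstr; lia].
        unfold H. eapply Nat.lt_le_trans; [apply code_bounds|].
        apply Nat.pow_le_mono_r; [lia|].
        specialize (Lh (decode (pk i w))).
        enough (length (decode (pk i w)) < i + S (S m)) by lia.
        apply (Nat.pow_lt_mono_r_iff 2); [lia|].
        eapply Nat.le_lt_trans; [apply code_bounds|]. rewrite code_decode, S_pk, Nat.pow_add_r.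
        apply Nat.mul_lt_mono_pos_l; [apply Nat.neq_0_lt_0, Nat.pow_nonzero; lia|].
        rewrite Nat.pow_succ_r'. lia.
      + apply decP_true. right. split; [|now apply Safe].
        intros D. apply decP_true in D. now rewrite D in Dw.
    - intros w w' y [B E] [B' E']. apply (Inj m); congruence. }
  specialize (Few m). pose proof (cnt_split (in_block m) (fun w => decP (dom U (decode (H w)))) (2 ^ S m)) as Sp.
  assert (2 ^ m <= cnt (in_block m) (2 ^ S m)) as Blk.
  { replace (2 ^ S m) with (2 ^ m + 2 ^ m) by (simpl; lia). apply cnt_from.
    intros w Lw. apply in_block_spec. simpl. lia. }
  unfold killed in Few.
  assert (2 * m <= 2 ^ m) as Lin.
  { clear. induction m as [|m IH]; [simpl; lia|]. rewrite Nat.pow_succ_r'.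
    destruct m; [simpl; lia|]. lia. }
  assert (2 ^ m <= 2 * cnt (err U A) (nstr (m + (c + i + 2)))) as Bd by lia.
  unfold nstr at 1. replace (S (m + (c + i + 2))) with (c + i + 3 + m) by lia.
  replace (c + i + 4) with (c + i + 3 + 1) by lia.
  rewrite !(Nat.pow_add_r 2 (c + i + 3)). change (2 ^ 1) with 2. nia.
Qed.

Lemma effectively_optimal_not_approx U : effectively_optimal U -> ~ approx_by_never_wrong U.
Proof.
  intros EU AU. destruct (effectively_optimal_errors U EU) as [d [r [Pd HU]]].
  assert (0 < / INR d)%R as Pe by (apply Rinv_0_lt_compat; now apply lt_0_INR).
  destruct (AU (/ INR d / 2)%R) as [A [MA [NW HA]]]; [lra|].
  destruct (HU A MA NW) as [N HN].
  assert (Rbar_le (Finite (/ INR d)) (E_lower U A)) as Low.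
  { apply LimInf_seq_ge with (N + r). intros n Ln. apply eps_n_ge.
    specialize (HN (n - r) ltac:(lia)). now replace (n - r + r) with n in HN by lia. }
  pose proof (Rbar_le_trans _ _ _ Low HA) as C. simpl in C. lra.
Qed.

(** * The four statements, with a universal machine and a left-total optimal machine as the two
    examples in (d) *)

Theorem theorem3p1 :
  (forall U : pfun, optimal U ->
     (* (a) *)
     (forall A, algorithm A -> Rbar_lt (Finite 0) (E_lower U A)) /\
     (* (b) *)
     (exists e : R, (0 < e)%R /\
        forall A, algorithm A -> Rbar_le (Finite e) (E_upper U A)) /\
     (* (c) *)
     (forall e : R, (0 < e)%R ->
        exists A, algorithm A /\ Rbar_le (E_lower U A) (Finite e))) /\
  (* (d) *)
  ((exists U, optimal U /\ approx_by_never_wrong U) /\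
   (exists U, optimal U /\ ~ approx_by_never_wrong U) /\
   (forall U, optimal U -> left_total U -> approx_by_never_wrong U) /\
   (forall U, effectively_optimal U -> ~ approx_by_never_wrong U)).
Proof.
  split; [|split; [|split; [|split]]].
  - intros U OU. destruct (E_lower_pos_E_upper_ge U OU) as [PA PB].
    split; [exact PA|]. split; [exact PB|]. apply E_lower_arbitrarily_small, OU.
  - destruct left_total_optimal_exists as [U [OU LU]]. exists U. split; [easy|].
    apply left_total_approx; [apply OU | easy].
  - destruct effectively_optimal_exists as [U EU]. exists U.
    split; [now apply effectively_optimal_optimal | now apply effectively_optimal_not_approx].
  - intros U [MU _]. now apply left_total_approx.
  - exact effectively_optimal_not_approx.
Qed.
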